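(* Let $G$ be Gossez's operator, $(Gx)_n=-\sum_{k<n}x_k+\sum_{k>n}x_k$ for $x=(x_k)_{k\in\mathbb N}\in\ell_1$, $n\in\mathbb N$, let $G^*:\ell_\infty^*\to\ell_\infty$ be the adjoint of the bounded linear operator $G:\ell_1\to\ell_\infty$, and let $\operatorname{cl}$ denote the closure in $\ell_\infty^*\times\ell_\infty$ with respect to any topology compatible with the duality $(\ell_\infty^*\times\ell_\infty,\ell_\infty\times\ell_\infty^* )$, such as $\sigma(\ell_\infty^*,\ell_\infty)\times\sigma(\ell_\infty,\ell_\infty^* )$. (i) With respect to the duality $(\ell_\infty^*,\ell_\infty)$, that is, when $G$ is seen as an operator $G:D(G)=\ell_1\subsetneq\ell_1^{**}=\ell_\infty^*\to\ell_\infty$, $G$ is skew, monotone and unique, and it is not NI, not representable, not $\sigma(\ell_\infty^*,\ell_\infty)\times\sigma(\ell_\infty,\ell_\infty^* )$-closed, not dual-representable, and not maximal monotone. The only maximal monotone extension of $G$ is $\neg G^*$ and (relative to the duality $(\ell_1\times\ell_\infty,\ell_\infty\times\ell_\infty^* )$) $$\operatorname{Graph}G\subset(\operatorname{Graph}G)^\perp=\operatorname{Graph}(\neg G^* ).$$ The Fitzpatrick function $\Phi_G$ of $G$ with respect to the duality $(\ell_\infty^*,\ell_\infty)$ and its conjugate are $$\Phi_G=\iota_{\operatorname{Graph}(\neg G^* )},\qquad \Psi_G:=\Phi_G^\square=\iota_{\operatorname{cl}(\operatorname{Graph}G)},$$ and $$L:=\operatorname{cl}(\operatorname{Graph}G)=[\Phi_G=c]=[\Psi_G=c]$$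 is a skew (that is, $L\subset[c=0]$) linear subspace of $\ell_\infty^*\times\ell_\infty$ which is unique and representable but not NI, not dual-representable, and not maximal monotone; but with $\Phi_G=\Phi_L$, $\Psi_G=\Psi_L$, and $$\operatorname{Graph}G\subsetneq L=[\Phi_L=c]=[\Psi_L=c]\subsetneq\operatorname{Graph}(\neg G^* ).$$ (ii) In contrast, the operator $\neg G:\ell_1\subsetneq\ell_\infty^*\to\ell_\infty$, $(\neg G)(x)=-Gx$, $x\in D(\neg G)=\ell_1$, is (with respect to the duality $(\ell_\infty^*,\ell_\infty)$) NI but not maximal monotone, with unique maximal monotone extension the skew operator with graph $\operatorname{cl}(\operatorname{Graph}(\neg G))=\neg L$.
   Context: All spaces are real. $\ell_1$ is the space of absolutely summable real sequences, $\ell_\infty=\ell_1^*$ the space of bounded real sequences with the sup norm, $\ell_\infty^*=\ell_1^{**}$ its topological dual. $\ell_1$ is regarded as a subspace of $\ell_\infty^*$ canonically, so the coupling $\langle\mu,y\rangle=\mu(y)$ of $(\ell_\infty^*,\ell_\infty)$ satisfies $\langle x,y\rangle=\sum_{n\in\mathbb N}x_ny_n$ for $x\in\ell_1$, $y\in\ell_\infty$. The adjoint is given by $\langle y,G^*\mu\rangle=\langle\mu,Gy\rangle$ for $y\in\ell_1$, $\mu\in\ell_\infty^*$. Let $X=\ell_\infty^*$, $Y=\ell_\infty$, $Z=X\times Y$, $c(x,y)=\langle x,y\rangle$ for $(x,y)\in Z$, and $z\cdot w:=\langle x,v\rangle+\langle u,y\rangle$ for $z=(x,y),\ w=(u,v)\in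 Z$. $\sigma(X,Y)$ (resp. $\sigma(Y,X)$) is the weakest topology making all maps $\langle\cdot,y\rangle$, $y\in Y$ (resp. $\langle x,\cdot\rangle$, $x\in X$) continuous. A locally convex topology on $Z$ is compatible with the duality if the continuous linear functionals on $Z$ are exactly the maps $z\mapsto z\cdot w$, $w\in Z$. For $f:Z\to\overline{\mathbb R}$, $f^\square(z)=\sup\{z\cdot z'-f(z')\mid z'\in Z\}$. For functions $f,g$ on $Z$, $[f=g]:=\{z\in Z\mid f(z)=g(z)\}$. For $A\subset Z$: $\iota_A(z)=0$ if $z\in A$ and $+\infty$ otherwise; the Fitzpatrick function of $A$ with respect to the duality $(\ell_\infty^*,\ell_\infty)$ is $\Phi_A(z)=\sup\{z\cdot w-c(w)\mid w\in A\}$, $z\in Z$, and $\Psi_A:=\Phi_A^\square$; $\neg A:=\{(x,y)\in Z\mid(x,-y)\in A\}$. For $T:X\rightrightarrows Y$, $\Phi_T,\Psi_T$ are those of $\operatorname{Graph}T$, and $\neg T$ is the operator with graph $\neg\operatorname{Graph}T$, i.e. $(\neg T)(x)=-T(x)$ on $D(\neg T)=D(T)$; in particular $\neg G^*=-G^*$. The orthogonal of $\operatorname{Graph}G\subset\ell_1\times\ell_\infty$ relative to $(\ell_1\times\ell_\infty,\ell_\infty\times\ell_\infty^* )$, with $(y,\mu)\in\ell_\infty\times\ell_\infty^*$ identified with $(\mu,y)\in\ell_\infty^*\times\ell_\infty$, is $(\operatorname{Graph}G)^\perp=\{(\mu,y)\in\ell_\infty^*\times\ell_\infty\mid\forall x\in\ell_1,\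 \langle x,y\rangle+\langle\mu,Gx\rangle=0\}$. Let $\mathscr R(Z)$ be the class of proper convex functions $f:Z\to\overline{\mathbb R}$ that are lower semicontinuous (for a topology compatible with the duality) with $f\ge c$ on $Z$, and $\mathscr D(Z)=\{f\in\mathscr R(Z)\mid f^\square\ge c\}$. An operator $T:X\rightrightarrows Y$ is: - monotone if $\langle x_1-x_2,y_1-y_2\rangle\ge0$ for all $y_1\in T(x_1)$, $y_2\in T(x_2)$; - maximal monotone if $\operatorname{Graph}T$ is maximal under inclusion among monotone subsets of $X\times Y$; - unique if $T$ is monotone and admits a unique maximal monotone extension in $Z$; - representable if $\operatorname{Graph}T=[f=c]$ for some $f\in\mathscr R(Z)$; - dual-representable if $\operatorname{Graph}T=[f=c]$ for some $f\in\mathscr D(Z)$; - NI (of negative infimum type) if $\Phi_T\ge c$ on $Z$; - skew if $\langle x,y\rangle=0$ for all $(x,y)\in\operatorname{Graph}T$; - closed (for a topology on $Z$) if its graph is closed. A subset $A\subset Z$ is said to have one of these properties if $A=\operatorname{Graph}T$ for some $T:X\rightrightarrows Y$ having that property. *)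

(* Defs.v *)
From HB Require Import structures.
From mathcomp Require Import all_boot all_order all_algebra.
From mathcomp Require Import all_classical all_reals all_analysis.

Set Implicit Arguments.
Unset Strict Implicit.
Unset Printing Implicit Defensive.
Import Order.TTheory GRing.Theory Num.Theory.
Import numFieldNormedType.Exports.
Local Open Scope classical_set_scope.
Local Open Scope ring_scope.

Section SequenceSpaces.
Variable R : realType.

Definition summable_seq : {pred nat -> R^o} :=
  fun x => `[< cvgn [normed series x] >].

Definition bounded_seq : {pred nat -> R^o} :=
  fun y => `[< exists M : R, forall n, `|y n| <= M >].

Lemma summable_seq_submod : submod_closed summable_seq.
Proof.
split.
  apply/asboolP; rewrite (_ : [normed series _] = cst 0); last first.
    by apply/funext => n; apply: big1 => i _; exact: normr0.
  exact: is_cvg_cst.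
move=> a x y /asboolP cx /asboolP cy; apply/asboolP.
apply: (@series_le_cvg _ _ (fun n => `|a| * `|x n| + `|y n|)).
- by move=> n; exact: normr_ge0.
- by move=> n; rewrite addr_ge0// mulr_ge0.
- by move=> n; rewrite (le_trans (ler_normD _ _))// lerD2r normrM.
- have cax := @is_cvg_seriesZ R (fun n => `|x n|) `|a| cx.
  exact: (@is_cvg_seriesD R _ _ cax cy).
Qed.

Lemma bounded_seq_submod : submod_closed bounded_seq.
Proof.
split; first by apply/asboolP; exists 0 => n; rewrite normr0.
move=> a x y /asboolP[M xM] /asboolP[N yN]; apply/asboolP.
exists (`|a| * M + N) => n.
by rewrite (le_trans (ler_normD _ _))// lerD// normrM ler_wpM2l.
Qed.

HB.instance Definition _ :=
  GRing.isSubmodClosed.Build R (nat -> R^o) summable_seq summable_seq_submod.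
HB.instance Definition _ :=
  GRing.isSubmodClosed.Build R (nat -> R^o) bounded_seq bounded_seq_submod.

Record ell1 := Ell1 { ell1_val :> nat -> R^o ; _ : ell1_val \in summable_seq }.
HB.instance Definition _ := [isSub for ell1_val].
HB.instance Definition _ := [Choice of ell1 by <:].
HB.instance Definition _ := [SubChoice_isSubLmodule of ell1 by <:].

Record linf := Linf { linf_val :> nat -> R^o ; _ : linf_val \in bounded_seq }.
HB.instance Definition _ := [isSub for linf_val].
HB.instance Definition _ := [Choice of linf by <:].
HB.instance Definition _ := [SubChoice_isSubLmodule of linf by <:].

Lemma ell1_cvg (x : ell1) : cvgn [normed series x].
Proof. by case: x => x /= /asboolP. Qed.

Lemma linf_bounded (y : linf) : exists M : R, forall n, `|y n| <= M.
Proof. by case: y => y /= /asboolP. Qed.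

Definition norm1 (x : ell1) : R := limn [normed series x].
Definition norm_inf (y : linf) : R := sup (range (fun n => `|y n|)).

Lemma norm_inf_sup (y : linf) : has_sup (range (fun n => `|y n|)).
Proof.
split; first by exists `|y 0%N|; exists 0%N.
by have [M yM] := linf_bounded y; exists M => _ [n _ <-].
Qed.

Lemma norm_inf_ub (y : linf) n : `|y n| <= norm_inf y.
Proof. by apply: ub_le_sup; [have [] := norm_inf_sup y|exists n]. Qed.

Lemma norm_inf_le (y : linf) (M : R) : (forall n, `|y n| <= M) -> norm_inf y <= M.
Proof.
move=> yM; apply: ge_sup; first by have [] := norm_inf_sup y.
by move=> _ [n _ <-].
Qed.

Lemma ler_norm_infD (x y : linf) : norm_inf (x + y) <= norm_inf x + norm_inf y.
Proof.
apply: norm_inf_le => n.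
by rewrite (le_trans (ler_normD _ _))// lerD// norm_inf_ub.
Qed.

Lemma norm_infZ (a : R) (x : linf) : norm_inf (a *: x) = `|a| * norm_inf x.
Proof.
have le (b : R) (y : linf) : norm_inf (b *: y) <= `|b| * norm_inf y.
  by apply: norm_inf_le => n; rewrite normrM ler_wpM2l// norm_inf_ub.
apply/eqP; rewrite eq_le le/=.
have [->|a0] := eqVneq a 0.
  by rewrite normr0 mul0r (le_trans _ (norm_inf_ub _ 0%N)).
by have := le a^-1 (a *: x); rewrite scalerK// normfV ler_pdivlMl ?normr_gt0.
Qed.

Lemma norm_inf0_eq0 (x : linf) : norm_inf x = 0 -> x = 0.
Proof.
move=> x0; apply/val_inj/funext => n; apply/eqP.
by rewrite -normr_le0 -x0 norm_inf_ub.
Qed.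

HB.instance Definition _ :=
  Lmodule_isNormed.Build R linf ler_norm_infD norm_infZ norm_inf0_eq0.

Lemma ler_norm1D (x y : ell1) : norm1 (x + y) <= norm1 x + norm1 y.
Proof.
have := @lim_seriesD R _ _ (@ell1_cvg x) (@ell1_cvg y).
rewrite /norm1 => <-; apply: lim_series_le.
- exact: ell1_cvg.
- exact: (@is_cvg_seriesD R _ _ (@ell1_cvg x) (@ell1_cvg y)).
- by move=> n; exact: ler_normD.
Qed.

Lemma norm1Z (a : R) (x : ell1) : norm1 (a *: x) = `|a| * norm1 x.
Proof.
apply: etrans (@lim_seriesZ R _ `|a| (@ell1_cvg x)).
congr (limn (series _)); apply/funext => n.
exact: normrM.
Qed.

Lemma series_le_norm1 (x : ell1) n : [normed series x] n <= norm1 x.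
Proof.
apply: nondecreasing_cvgn_le (@ell1_cvg x) _.
by apply: nondecreasing_series => *; exact: normr_ge0.
Qed.

Lemma norm1_ub (x : ell1) n : `|x n| <= norm1 x.
Proof.
apply: le_trans (series_le_norm1 x n.+1).
have -> : [normed series x] n.+1 = [normed series x] n + `|x n|.
  exact: big_nat_recr.
by rewrite lerDr; apply: sumr_ge0 => i _; exact: normr_ge0.
Qed.

Lemma norm1_eq0 (x : ell1) : norm1 x = 0 -> x = 0.
Proof.
move=> x0; apply/val_inj/funext => n; apply/eqP.
by rewrite -normr_le0 -x0 norm1_ub.
Qed.

HB.instance Definition _ :=
  Lmodule_isNormed.Build R ell1 ler_norm1D norm1Z norm1_eq0.

End SequenceSpaces.

Section TopologicalDual.
Variables (R : realType) (V : normedModType R).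

Definition continuous_scalar : {pred V -> R^o} :=
  fun mu => `[< scalar mu /\ continuous mu >].

Lemma continuous_scalar_submod : submod_closed continuous_scalar.
Proof.
split.
  apply/asboolP; split; last exact: cst_continuous.
  by move=> a u v; rewrite /= mulr0 addr0.
move=> a f g /asboolP[lf cf] /asboolP[lg cg]; apply/asboolP; split.
  move=> b u v.
  change (a * f (b *: u + v) + g (b *: u + v) =
    b * (a * f u + g u) + (a * f v + g v)).
  by rewrite lf lg !mulrDr mulrCA addrACA.
by move=> y; exact: cvgD (cvgM (cvg_cst (a : R)) (cf y)) (cg y).
Qed.

HB.instance Definition _ := GRing.isSubmodClosed.Build R (V -> R^o)
  continuous_scalar continuous_scalar_submod.

Record topdual := TopDual {
  topdual_val :> V -> R^o ; _ : topdual_val \in continuous_scalar }.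
HB.instance Definition _ := [isSub for topdual_val].
HB.instance Definition _ := [Choice of topdual by <:].
HB.instance Definition _ := [SubChoice_isSubLmodule of topdual by <:].

End TopologicalDual.

Section GossezOperator.
Variable R : realType.
Local Notation ell1 := (ell1 R).
Local Notation linf := (linf R).
Local Notation X := (topdual linf).

Let pack_scalar (V : normedModType R) (phi : V -> R^o) (lphi : scalar phi) :
  {linear V -> R^o} := HB.pack phi (GRing.isLinear.Build _ _ _ _ _ lphi).

Lemma scalar_continuousP (V : normedModType R) (phi : V -> R^o) :
  scalar phi ->
  continuous phi <-> exists M : R, forall v, `|phi v| <= M * `|v|.
Proof.
move=> lphi; split=> [cphi|[M phiM]].
  have /linear_boundedP h := @continuous_linear_bounded _ _ _ 0 (pack_scalar lphi) (cphi 0).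
  near +oo_R => r; exists r; near: r; exact: h.
apply: (@bounded_linear_continuous _ _ _ (pack_scalar lphi)).
apply/linear_boundedP; near=> r => v; apply: le_trans (phiM v) _.
by rewrite ler_wpM2r//; near: r; exact: nbhs_pinfty_ge (num_real _).
Unshelve. all: by end_near. Qed.

Lemma topdual_scalar (V : normedModType R) (mu : topdual V) : scalar mu.
Proof. by case: mu => mu /= /asboolP[]. Qed.

Lemma topdual_bounded (V : normedModType R) (mu : topdual V) :
  exists M : R, forall v, `|mu v| <= M * `|v|.
Proof.
by apply/(scalar_continuousP (@topdual_scalar _ mu)); case: mu => mu /= /asboolP[].
Qed.

Lemma ell1_series_cvg (x : ell1) : cvgn (series x).
Proof. exact: (@normed_cvg _ R^o _ (@ell1_cvg _ x)). Qed.

(* The coupling of ell1 and linf, which is also the canonical embedding of ell1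
   into linf^*. *)
Definition pairing (x : ell1) (y : linf) : R := limn (series (fun n => x n * y n)).

Lemma pairing_normed_cvg (x : ell1) (y : linf) :
  cvgn [normed series (fun n => x n * y n)].
Proof.
apply: (@series_le_cvg _ _ (fun n => `|y| * `|x n|)).
- by move=> n; exact: normr_ge0.
- by move=> n; rewrite mulr_ge0.
- by move=> n; rewrite /= normrM mulrC ler_wpM2r// norm_inf_ub.
- exact: is_cvg_seriesZ (@ell1_cvg _ x).
Qed.

Lemma pairing_cvg (x : ell1) (y : linf) : cvgn (series (fun n => x n * y n)).
Proof. exact: (@normed_cvg _ R^o _ (@pairing_normed_cvg x y)). Qed.

Lemma pairing_scalar (x : ell1) : scalar (pairing x).
Proof.
move=> a u v.
have cau := is_cvg_seriesZ (k := a) (@pairing_cvg x u).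
have e := lim_seriesD cau (@pairing_cvg x v).
rewrite (lim_seriesZ a (@pairing_cvg x u)) in e; apply: etrans e.
congr (limn (series _)); apply/funext => n.
change (x n * (a * u n + v n) = a * (x n * u n) + x n * v n).
by rewrite mulrDr mulrCA.
Qed.

Lemma pairing_le (x : ell1) (y : linf) : `|pairing x y| <= `|x| * `|y|.
Proof.
apply: le_trans (@lim_series_norm _ R^o _ (@pairing_normed_cvg x y)) _.
have e := lim_seriesZ `|y| (@ell1_cvg _ x).
have -> : `|x| * `|y| = limn (series (`|y| *: (fun n => `|x n|))).
  by rewrite e mulrC.
apply: lim_series_le; first exact: pairing_normed_cvg.
  exact: is_cvg_seriesZ (@ell1_cvg _ x).
by move=> n; rewrite /= normrM mulrC ler_wpM2r// norm_inf_ub.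
Qed.

Lemma pairing_dual (x : ell1) : (pairing x : linf -> R^o) \in @continuous_scalar R linf.
Proof.
apply/asboolP; split; first exact: pairing_scalar.
apply/(scalar_continuousP (@pairing_scalar x)); exists `|x| => y.
exact: pairing_le.
Qed.

Definition ell1_bidual (x : ell1) : X := TopDual (pairing_dual x).

Definition gossez_seq (x : nat -> R^o) : nat -> R^o := fun n =>
  - (\sum_(0 <= k < n) x k) + limn (fun m => \sum_(n.+1 <= k < m) x k).

Lemma gossez_seqE (x : ell1) n :
  gossez_seq x n = limn (series x) - series x n.+1 - series x n.
Proof.
rewrite /gossez_seq addrC; congr (_ - _).
apply/cvg_lim => //; apply: cvg_trans (cvgB (@ell1_series_cvg x) (cvg_cst (series x n.+1))).
apply: near_eq_cvg; near=> m.
have e : series x m - series x n.+1 = \sum_(n.+1 <= k < m) x k.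
  by apply: sub_series_geq; near: m; exact: nbhs_infty_ge.
exact: e.
Unshelve. all: by end_near. Qed.

Lemma series_norm1 (x : ell1) n : `|series x n| <= `|x|.
Proof. exact: le_trans (ler_norm_sum _ _ _) (series_le_norm1 x n). Qed.

Lemma gossez_seq_le (x : ell1) n : `|gossez_seq x n| <= 3 * `|x|.
Proof.
rewrite gossez_seqE (_ : 3 = 1 + 1 + 1) 1?(natrD _ 2 1)//.
rewrite !mulrDl !mul1r (le_trans (ler_normB _ _))// lerD ?series_norm1//.
rewrite (le_trans (ler_normB _ _))// lerD ?series_norm1//.
exact: (@lim_series_norm _ R^o _ (@ell1_cvg _ x)).
Qed.

Lemma gossez_seq_bounded (x : ell1) : gossez_seq x \in @bounded_seq R.
Proof. by apply/asboolP; exists (3 * `|x|) => n; exact: gossez_seq_le. Qed.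

Definition gossez (x : ell1) : linf := Linf (gossez_seq_bounded x).

Lemma gossez_linear : linear gossez.
Proof.
move=> a x y; apply/val_inj/funext => n.
change (gossez_seq (a *: x + y : ell1) n = a * gossez_seq x n + gossez_seq y n).
rewrite !gossez_seqE.
have sD m : series (a *: x + y : ell1) m = a * series x m + series y m.
  by rewrite /series/= mulr_sumr -big_split.
have -> : limn (series (a *: x + y : ell1)) = a * limn (series x) + limn (series y).
  have e := lim_seriesD (is_cvg_seriesZ (k := a) (@ell1_series_cvg x)) (@ell1_series_cvg y).
  by rewrite (lim_seriesZ a (@ell1_series_cvg x)) in e.
by rewrite !sD !mulrBr !opprD [X in X + _ = _]addrACA [LHS]addrACA.
Qed.

HB.instance Definition _ := GRing.isLinear.Build R ell1 linf _ gossez gossez_linear.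

Lemma gossez_le (x : ell1) : `|gossez x| <= 3 * `|x|.
Proof. by apply: norm_inf_le => n; exact: gossez_seq_le. Qed.
End GossezOperator.

Section Adjoint.
Variable R : realType.
Local Notation ell1 := (ell1 R).
Local Notation linf := (linf R).
Local Notation X := (topdual linf).

(* The element y of linf = (ell1)^* representing x |-> mu (A x); the default 0
   is never used for the operator below, see [gossez_adjointP] and
   [adjoint_unique]. *)
Definition adjoint (A : ell1 -> linf) (mu : X) : linf :=
  xget 0 [set y | forall x, pairing x y = mu (A x)].

Definition unit_seq (n : nat) : nat -> R^o := fun k => (k == n)%:R.

Lemma series_eventually_cst (u : nat -> R) N :
  (forall k, (N <= k)%N -> u k = 0) -> series u @ \oo --> series u N.
Proof.
move=> u0; apply: cvg_near_cst; near=> m.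
have Nm : (N <= m)%N by near: m; exact: nbhs_infty_ge.
apply/eqP; rewrite -subr_eq0 sub_series_geq// big_nat_cond big1// => k.
by rewrite andbT => /andP[/u0].
Unshelve. all: by end_near. Qed.

Lemma unit_seq_summable n : unit_seq n \in @summable_seq R.
Proof.
apply/asboolP/cvg_ex; eexists; apply: (@series_eventually_cst _ n.+1) => k nk.
by rewrite /= /unit_seq gtn_eqF// normr0.
Qed.

Definition unit_ell1 n : ell1 := Ell1 (unit_seq_summable n).

Lemma norm_unit_ell1 n : `|unit_ell1 n| <= 1.
Proof.
rewrite (_ : `|unit_ell1 n| = series (fun k => `|unit_seq n k|) n.+1); last first.
  apply/cvg_lim => //; apply: series_eventually_cst => k nk.
  by rewrite /= /unit_seq gtn_eqF// normr0.
rewrite /series/= (bigD1_seq n) ?mem_index_iota ?iota_uniq//= /unit_seq eqxx normr1.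
by rewrite big1 ?addr0// => i /negbTE ->; rewrite normr0.
Qed.

Definition trunc_ell1 (x : ell1) N : ell1 := \sum_(0 <= k < N) (x k : R) *: unit_ell1 k.

Lemma trunc_ell1E (x : ell1) N n : trunc_ell1 x N n = if (n < N)%N then x n else 0.
Proof.
elim: N => [|N IH]; first by rewrite /trunc_ell1 big_geq.
rewrite /trunc_ell1 big_nat_recr//=.
change (trunc_ell1 x N n + x N * (n == N)%:R = if (n < N.+1)%N then x n else 0).
rewrite IH [in RHS]ltnS [in RHS]leq_eqVlt; case: eqVneq => [->|nN] /=.
  by rewrite ltnn add0r mulr1.
by rewrite mulr0 addr0.
Qed.

Lemma norm_trunc_ell1 (x : ell1) N :
  `|x - trunc_ell1 x N| = `|x| - [normed series x] N.
Proof.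
apply/cvg_lim => //.
apply: cvg_trans (cvgB (@ell1_cvg _ x) (cvg_cst ([normed series x] N))).
apply: near_eq_cvg; near=> m.
have Nm : (N <= m)%N by near: m; exact: nbhs_infty_ge.
have e : [normed series x] m - [normed series x] N = \sum_(N <= k < m) `|x k|.
  exact: sub_series_geq.
apply: etrans e _.
change (\sum_(N <= k < m) `|x k| = \sum_(0 <= k < m) `|x k - trunc_ell1 x N k|).
have z : \sum_(0 <= k < N) `|x k - trunc_ell1 x N k| = 0.
  rewrite big_nat; apply: big1 => k /andP[_ kN].
  by rewrite trunc_ell1E kN subrr normr0.
rewrite [RHS](@big_cat_nat _ _ _ N)//= z add0r; apply: eq_big_nat => k /andP[Nk _].
by rewrite trunc_ell1E ltnNge Nk subr0.
Unshelve. all: by end_near. Qed.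

Lemma adjoint_ex (A : {linear ell1 -> linf}) (C : R) (mu : X) :
  (forall x, `|A x| <= C * `|x|) ->
  exists y : linf, forall x, pairing x y = mu (A x).
Proof.
move=> AC; have [M muM] := topdual_bounded mu.
have lmu := topdual_scalar mu.
have lA (a : R) (u v : ell1) : A (a *: u + v) = a *: A u + A v by exact: linearP.
have muAC x : `|mu (A x)| <= `|M| * C * `|x|.
  apply: le_trans (muM _) _; rewrite -mulrA.
  by apply: le_trans (ler_wpM2l (normr_ge0 M) (AC x)); rewrite ler_wpM2r// ler_norm.
have yb : (fun n => mu (A (unit_ell1 n))) \in @bounded_seq R.
  apply/asboolP; exists (`|M| * `|C|) => n; apply: le_trans (muAC _) _.
  rewrite -mulrA ler_wpM2l// (le_trans (ler_norm _))// normrM normr_id.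
  by rewrite ler_piMr// norm_unit_ell1.
exists (Linf yb) => x.
have sE N : series (fun n => x n * Linf yb n) N = mu (A (trunc_ell1 x N)).
  elim: N => [|N IH].
    rewrite /series/= /trunc_ell1 !big_geq// linear0.
    by have := lmu (-1) 0 0; rewrite scaleN1r oppr0 addr0 mulN1r addNr => ->.
  have -> : trunc_ell1 x N.+1 = (x N : R) *: unit_ell1 N + trunc_ell1 x N.
    by rewrite /trunc_ell1 big_nat_recr//= addrC.
  rewrite lA lmu -IH addrC.
  exact: big_nat_recr.
apply/cvg_lim => //.
apply/subr_cvg0/norm_cvg0P.
have h : (fun N => `|M| * C * (`|x| - [normed series x] N)) @ \oo --> (0 : R).
  rewrite -(mulr0 (`|M| * C)) -(subrr `|x|).
  by apply: cvgMl_tmp; apply: cvgB; [exact: cvg_cst|exact: ell1_cvg].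
apply: squeeze_cvgr (cvg_cst 0) h; near=> N.
rewrite normr_ge0/= distrC.
have -> : mu (A x) - series (fun n => x n * Linf yb n) N = mu (A (x - trunc_ell1 x N)).
  rewrite sE -[x - _]addrC -[- trunc_ell1 x N]scaleN1r lA lmu mulN1r.
  by rewrite addrC.
by rewrite -norm_trunc_ell1.
Unshelve. all: by end_near. Qed.

Lemma gossez_adjointP (mu : X) (x : ell1) :
  pairing x (adjoint (@gossez R) mu) = mu (gossez x).
Proof.
rewrite /adjoint; case: xgetP => [y _ yP|no]; first exact: yP.
have [y yP] := adjoint_ex mu (@gossez_le R).
by have := no y; case.
Qed.

Lemma pairing_unit n (y : linf) : pairing (unit_ell1 n) y = y n.
Proof.
apply/cvg_lim => //; rewrite (_ : y n = series (fun k => unit_ell1 n k * y k) n.+1).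
  apply: series_eventually_cst => k nk.
  by rewrite /= /unit_seq gtn_eqF// mul0r.
rewrite /series/= (bigD1_seq n) ?mem_index_iota ?iota_uniq//= /unit_seq eqxx mul1r.
by rewrite big1 ?addr0// => i /negbTE ->; rewrite mul0r.
Qed.

Lemma adjoint_unique (A : ell1 -> linf) (mu : X) (y : linf) :
  (forall x, pairing x y = mu (A x)) -> adjoint A mu = y.
Proof.
move=> yP; rewrite /adjoint; case: xgetP => [y' _ y'P|/(_ y)//].
by apply/val_inj/funext => n; rewrite /= -!pairing_unit y'P yP.
Qed.
End Adjoint.

(* A topology on a given type T is an element t of the library class
   [Topological T], and [Topological.Pack t] is the corresponding space. *)
Section TopologiesOnTypes.
Variables (R : realType) (T : Type).

Definition closure_for (t : Topological T) (A : set T) : set T :=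
  @closure (Topological.Pack t) A.

Definition closed_for (t : Topological T) (A : set T) : Prop :=
  @closed (Topological.Pack t) A.

Definition lsc_for (t : Topological T) (f : T -> \bar R) : Prop :=
  lower_semicontinuous (f : Topological.Pack t -> \bar R).

Definition proper_fun (f : T -> \bar R) : Prop :=
  (forall z, f z != -oo%E) /\ (exists z, f z != +oo%E).

Definition indicator_fun (A : set T) (z : T) : \bar R :=
  if z \in A then 0%E else +oo%E.

End TopologiesOnTypes.

Section TopologiesOnModules.
Variables (R : realType) (V : lmodType R).

(* The conditions are the ones of the factory [PreTopologicalLmod_isTvs]. *)
Definition locally_convex_topology (t : Topological V) : Prop :=
  let E := Topological.Pack t in
  [/\ continuous (fun p : E * E => ((p.1 : V) + (p.2 : V) : E)),
      continuous (fun p : R^o * E => ((p.1 : R) *: (p.2 : V) : E))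
    & exists2 B : set_system E,
        (forall b, b \in B -> convex_set (b : set (convex_lmodType V)))
        & basis B].

(* Only meaningful for functions that do not take the value -oo. *)
Definition convex_efun (f : V -> \bar R) : Prop :=
  forall (z w : V) (a : R), 0 < a -> a < 1 ->
    (f (a *: z + (1 - a) *: w)%R <= a%:E * f z + (1 - a)%:E * f w)%E.

End TopologiesOnModules.

Section Duality.
Variables (R : realType) (Y : normedModType R).
Local Notation X := (topdual Y).
Local Notation Z := (X * Y)%type.

Definition coupling (z : Z) : R := z.1 z.2.

Definition zdot (z w : Z) : R := z.1 w.2 + w.1 z.2.

Definition sigmaX : topologicalType :=
  sup_topology (fun y : Y => Topological.on (initial_topology (fun x : X => x y))).

Definition sigmaY : topologicalType :=
  sup_topology (fun x : X => Topological.on (initial_topology (fun y : Y => x y))).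

Definition sigmaZ : Topological Z := Topological.class (sigmaX * sigmaY)%type.

Definition compatible_topology (t : Topological Z) : Prop :=
  locally_convex_topology t /\
  forall phi : Z -> R,
    (scalar phi /\ continuous (phi : Topological.Pack t -> R^o)) <->
    exists w, phi = zdot^~ w.

Definition conjugate (f : Z -> \bar R) (z : Z) : \bar R :=
  ereal_sup (range (fun w => (zdot z w)%:E - f w))%E.

Definition fitzpatrick (A : set Z) (z : Z) : \bar R :=
  ereal_sup [set (zdot z w - coupling w)%:E | w in A].

Definition fitzpatrick_conj (A : set Z) : Z -> \bar R := conjugate (fitzpatrick A).

Definition coincidence (f : Z -> \bar R) : set Z := [set z | f z = (coupling z)%:E].

Definition neg_set (A : set Z) : set Z := [set z | A (z.1, - z.2)].

Definition class_R (f : Z -> \bar R) : Prop :=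
  [/\ proper_fun f, convex_efun f,
      (exists2 t, compatible_topology t & lsc_for t f)
    & forall z, ((coupling z)%:E <= f z)%E].

Definition class_D (f : Z -> \bar R) : Prop :=
  class_R f /\ forall z, ((coupling z)%:E <= conjugate f z)%E.

(* The properties of operators are stated on their graphs: every subset of Z is
   the graph of exactly one multivalued operator. *)
Definition op_graph (T : X -> set Y) : set Z := [set z | T z.1 z.2].

Definition op_domain (T : X -> set Y) : set X := [set x | T x !=set0].

Definition neg_op (T : X -> set Y) : X -> set Y := fun x => [set y | T x (- y)].

Definition monotone_set (A : set Z) : Prop :=
  forall z w, A z -> A w -> 0 <= coupling (z - w).

Definition maximal_monotone (A : set Z) : Prop :=
  monotone_set A /\ forall B, monotone_set B -> A `<=` B -> B = A.

Definition maximal_monotone_extension (A M : set Z) : Prop :=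
  maximal_monotone M /\ A `<=` M.

Definition unique_monotone (A : set Z) : Prop :=
  monotone_set A /\ exists! M, maximal_monotone_extension A M.

Definition representable (A : set Z) : Prop :=
  exists2 f, class_R f & A = coincidence f.

Definition dual_representable (A : set Z) : Prop :=
  exists2 f, class_D f & A = coincidence f.

Definition NI (A : set Z) : Prop :=
  forall z, ((coupling z)%:E <= fitzpatrick A z)%E.

Definition skew_set (A : set Z) : Prop := A `<=` [set z | coupling z = 0].

Definition linear_subspace (A : set Z) : Prop := submod_closed (mem A).

End Duality.

Section GossezGraph.
Variable R : realType.
Local Notation ell1 := (ell1 R).
Local Notation linf := (linf R).
Local Notation X := (topdual linf).

(* The operator from linf^* to linf with domain the canonical image of ell1 in
   its bidual. *)
Definition gossez_op : X -> set linf :=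
  fun mu => [set gossez x | x in [set x : ell1 | ell1_bidual x = mu]].

Definition gossez_adjoint : X -> set linf :=
  fun mu => [set adjoint (@gossez R) mu].

(* The graph of the operator inside ell1 * linf, as opposed to linf^* * linf. *)
Definition gossez_graph1 : set (ell1 * linf) := range (fun x => (x, gossez x)).

(* The orthogonal in linf * linf^* of a subset of ell1 * linf, its elements
   (y, mu) being written (mu, y). *)
Definition graph_orthogonal (A : set (ell1 * linf)) : set (X * linf) :=
  [set w : X * linf | forall z, A z -> pairing z.1 w.2 + w.1 z.2 = 0].

End GossezGraph.

(* Main.v *)
Require Import Defs.
From HB Require Import structures.
From mathcomp Require Import all_boot all_order all_algebra.
From mathcomp Require Import all_classical all_reals all_analysis.
From mathcomp Require Import ring lra.

(** Let [perp A] be the orthogonal of [A] for the symmetric bilinear form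
    [zdot], whose quadratic form is twice the coupling.  For a skew linear
    subspace [A] all the notions of the theorem can be read off [perp A] and
    [perp (perp A)].  The Fitzpatrick function of [A] is the supremum of a linear
    functional over a subspace, hence the indicator of [perp A]
    ([fitzpatrick_skew]), and its conjugate is the indicator of
    [perp (perp A)] ([conjugate_indicator]), which by Hahn-Banach is the closure
    of [A] for every compatible topology ([closure_perp]).  A monotone set [M]
    containing [A] is included in [perp A]: for [z] in [M] and [w] in [A] the
    coupling of [z - k *: w] is affine in [k] with slope [- zdot z w]
    ([monotone_extension_perp]).  So the monotone extensions of [A] only depend
    on the sign of the coupling on [perp A].

    Let [G] be the graph of the Gossez operator and [e] the constant sequence 1.
    Testing [(mu, y)] in [perp G] against the unit vectors gives
    [y = gossez x + a *: e], where [x] is the sequence of the values of [mu] at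
    the unit vectors and [a] is [mu e] minus the sum of [x]
    ([perp_gossez_decomposition]); since [gossez] is skew, the coupling of
    [(mu, y)] is then [a ^+ 2] ([perp_gossez_square]).  A limit [nu] along a free
    ultrafilter gives the point [u = (nu, e)] of [perp G] with [a = 1], and
    [2 * a] is [zdot u (mu, y)].  Hence the coupling is nonnegative on [perp G],
    which is therefore the only maximal monotone extension of [G], and it
    vanishes exactly on the hyperplane [perp (perp G)] of [perp G].  The latter
    is strictly larger than [G]: it contains [(nu0, 0)], where [nu0] is the
    difference of [nu] and its shift.

    After the change of sign of the second component the coupling is nonpositive
    on the orthogonal.  Then the Fitzpatrick function is above the coupling, and
    a monotone extension can only contain points of the orthogonal with coupling
    0, that is, points of the closure ([maximal_extension_perp2]).

    If [L = perp (perp G)] were the coincidence set of [f], with [f] and its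
    conjugate above the coupling, then [f] would be infinite outside [perp G] and
    the conjugate of [f] at [u] would be at least 1; this forces points [g *: u]
    with [g] close to 1 and [f (g *: u)] close to 1, so that [f u = 1] by
    semicontinuity and [u] would be in [L]
    ([not_dual_representable_perp2]). *)

Import Order.TTheory GRing.Theory Num.Theory.
Import numFieldNormedType.Exports.
Set Implicit Arguments.
Unset Strict Implicit.
Unset Printing Implicit Defensive.
Local Open Scope classical_set_scope.
Local Open Scope ring_scope.

(** * Linear subsets and the Hahn-Banach theorem *)

Definition linear_set (R : realType) (V : lmodType R) (A : set V) : Prop :=
  A 0 /\ forall (a : R) u v, A u -> A v -> A (a *: u + v).

Section LinearSet.
Variables (R : realType) (V : lmodType R) (A : set V).
Hypothesis linA : linear_set A.

Lemma linear_setD u v : A u -> A v -> A (u + v).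
Proof. by move=> Au Av; rewrite -[u]scale1r; exact: linA.2. Qed.

Lemma linear_setZ (a : R) u : A u -> A (a *: u).
Proof. by move=> Au; rewrite -[_ *: _]addr0; apply: linA.2 => //; exact: linA.1. Qed.

Lemma linear_setB u v : A u -> A v -> A (u - v).
Proof.
by move=> Au Av; apply: linear_setD => //; rewrite -scaleN1r; exact: linear_setZ.
Qed.

End LinearSet.

Section HahnBanach.
Variables (R : realType) (V : lmodType R).

Lemma convex_setP (U : set V) : convex_set (U : set (convex_lmodType V)) <->
  forall x y (a : R), U x -> U y -> 0 <= a -> a <= 1 -> U (a *: x + (1 - a) *: y).
Proof.
split=> [cU x y a Ux Uy a0 a1|cU x y l /set_mem Ux /set_mem Uy].
  have a01 : 0 <= a <= 1 by rewrite a0.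
  pose t : {i01 R} := @Itv01 R a a0 a1.
  by have /set_mem := cU x y t (mem_set Ux) (mem_set Uy).
by apply/mem_set; exact: cU.
Qed.

Variable U : set V.
Hypotheses (U0 : U 0) (convU : convex_set (U : set (convex_lmodType V)))
  (absU : forall v, exists2 e : R, 0 < e & U (e *: v)).

(** Graph of a partial linear functional that is at most 1 on [U].  It is
    single-valued as soon as [U] contains 0: a value [r <> 0] at 0 would have the
    multiple 2 there.  Comparing with 1 on [U] avoids the Minkowski
    gauge. *)
Definition dominated (g : set (V * R^o)) : Prop :=
  linear_set g /\ forall v r, g (v, r) -> U v -> r <= 1.

(** A value [a] at [v0] is admissible iff it is above the quotients
    [(r - 1) / s] with [v - s *: v0] in [U] and below the quotients
    [(1 - r) / t] with [v + t *: v0] in [U].  A quotient of the first kind never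
    exceeds one of the second, because the convex combination of the two points
    of [U] that cancels [v0] is in the domain of [g]. *)
Lemma dominated_extension (g : set (V * R^o)) (v0 : V) : dominated g ->
  exists a : R, dominated
    [set p | exists2 q, g q & exists t : R, p = (q.1 + t *: v0, q.2 + t * a)].
Proof.
move=> [lg gU].
pose S := [set x : R | exists v r s,
  [/\ g (v, r), 0 < s, U (v - s *: v0) & x = (r - 1) / s]].
have below v r t x : g (v, r) -> 0 < t -> U (v + t *: v0) -> S x ->
    x <= (1 - r) / t.
  move=> gvr t0 Uv [v' [r' [s [gv'r' s0 Uv' ->]]]].
  rewrite ler_pdivrMr// mulrAC ler_pdivlMr//.
  have st0 : 0 < s + t by rewrite addr_gt0.
  have /convex_setP cU := convU.
  have a0 : 0 <= t / (s + t) by rewrite divr_ge0// ltW.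
  have a1 : t / (s + t) <= 1 by rewrite ler_pdivrMr// mul1r lerDr ltW.
  have := cU _ _ _ Uv' Uv a0 a1.
  have e : 1 - t / (s + t) = s / (s + t) by field; rewrite gt_eqF.
  rewrite e scalerBr scalerDr !scalerA addrACA.
  rewrite (_ : t / (s + t) * s = s / (s + t) * t); last by field; rewrite gt_eqF.
  rewrite addNr addr0 => Uc.
  have gc := lg.2 (t / (s + t)) _ _ gv'r' (linear_setZ lg (s / (s + t)) gvr).
  have := gU _ _ gc Uc.
  rewrite /= -[_ *: r']/(_ * r') -[_ *: r]/(_ * r).
  rewrite (_ : _ + _ = (t * r' + s * r) / (s + t)); last by field; rewrite gt_eqF.
  by rewrite ler_pdivrMr// mul1r => h; lra.
have S0 : S !=set0.
  have [e e0 Ue] := absU (- v0).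
  exists ((0 - 1) / e); exists 0, 0, e; split => //; first exact: lg.1.
  by rewrite sub0r -scalerN.
have [e e0 Ue] := absU v0.
have ubS : has_ubound S.
  exists ((1 - 0) / e) => x; apply: below => //; first exact: lg.1.
  by rewrite add0r.
exists (sup S); split.
  split; first by exists (0, 0); [exact: lg.1|exists 0; rewrite scale0r mul0r /= !addr0].
  move=> k _ _ [[v r] gvr [t ->]] [[v' r'] gvr' [t' ->]] /=.
  exists (k *: (v, r : R^o) + (v', r' : R^o)); first exact: lg.2.
  exists (k * t + t') => /=; congr (_, _).
    by rewrite /= scalerDr scalerDl scalerA addrACA.
  by rewrite /= -![_ *: _]/(_ * _); ring.
move=> w x [[v r] gvr [t [-> ->]]] /= Uv.
have [t0|t0|t0] := ltgtP t 0.
- suff : (r - 1) / (- t) <= sup S by rewrite ler_pdivrMr ?oppr_gt0//; lra.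
  apply: ub_le_sup => //; exists v, r, (- t); split; rewrite ?oppr_gt0//.
  by rewrite scaleNr opprK.
- suff : sup S <= (1 - r) / t by rewrite ler_pdivlMr//; lra.
  by apply: ge_sup => // y; exact: below gvr t0 Uv.
- by move: Uv; rewrite t0 scale0r mul0r !addr0; exact: gU.
Qed.

Theorem hahn_banach_convex (g0 : set (V * R^o)) : dominated g0 ->
  exists phi : V -> R^o, [/\ scalar phi, forall v, U v -> phi v <= 1
    & forall v r, g0 (v, r) -> phi v = r].
Proof.
move=> dg0.
(* The union with [g0] makes the empty chain harmless. *)
pose P : set (set (V * R^o)) := [set g | dominated (g0 `|` g)].
have [|g [Pg gmax]] := @Zorn_bigcup _ P.
  move=> F FP Ftot; rewrite /P /=.
  have [[X FX]|F0] := pselect (exists X, F X); last first.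
    rewrite [X in g0 `|` X](_ : _ = set0) ?setU0//.
    by apply/seteqP; split => // x [X FX]; case: F0; exists X.
  split.
    split; first by left; exact: dg0.1.1.
    have key X1 X2 : F X1 -> F X2 -> exists2 Y, F Y & X1 `<=` Y /\ X2 `<=` Y.
      move=> F1 F2; case: (Ftot _ _ F1 F2) => h; first by exists X2 => //; split.
      by exists X1 => //; split.
    have up u : (g0 `|` \bigcup_(X in F) X) u -> exists2 Y, F Y & (g0 `|` Y) u.
      by move=> [?|[Y FY Yu]]; [exists X => //; left|exists Y => //; right].
    move=> a u v /up[Y1 F1 h1] /up[Y2 F2 h2]; have [Y FY [Y1Y Y2Y]] := key _ _ F1 F2.
    have {}h1 : (g0 `|` Y) u by case: h1; [left|right; exact: Y1Y].
    have {}h2 : (g0 `|` Y) v by case: h2; [left|right; exact: Y2Y].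
    have [//|h] := (FP Y FY).1.2 a _ _ h1 h2; first by left.
    by right; exists Y.
  move=> v r [h|[Y FY Yv]]; first exact: dg0.2 h.
  by apply: (FP Y FY).2; right.
have g0g : g0 `<=` g.
  apply: contrapT => /existsNP[x /not_implyP[g0x gx]].
  apply: (gmax (g0 `|` g)); last by rewrite /P /= setUA setUid.
  by split; [exact: subsetUr|move=> /(_ x); apply: contra_not gx => /(_ (or_introl g0x))].
have dg : dominated g by move: Pg; rewrite /P /= (setUidr g0g).
have total v : exists r, g (v, r).
  apply: contrapT => nv; have [a da] := dominated_extension v dg.
  set g' := (X in dominated X) in da.
  have gg' : g `<=` g'.
    by move=> [w r] gwr; exists (w, r) => //; exists 0; rewrite /= scale0r mul0r !addr0.
  apply: (gmax g').
    split=> // /(_ (v, a)) h; apply: nv; exists a; apply: h.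
    by exists (0, 0); [exact: dg.1.1|exists 1; rewrite scale1r mul1r !add0r].
  by rewrite /P /= (setUidr (fun x h => gg' x (g0g x h))).
have fct0 r : g (0, r) -> r = 0.
  move=> gr; apply/eqP; apply: contrapT => /negP r0.
  have := dg.2 _ _ (linear_setZ dg.1 (2 / r) gr); rewrite scaler0 => /(_ U0).
  by rewrite -[_ *: _]/(_ * _) divfK//; lra.
have fct v r s : g (v, r) -> g (v, s) -> r = s.
  move=> gr gs; apply/eqP; rewrite -subr_eq0; apply/eqP/fct0.
  by have := linear_setB dg.1 gr gs; rewrite /= -[(v, r) - _]/(v - v, r - s) subrr.
have [phi phiP] := choice total.
exists phi; split.
- move=> a u v; apply: fct (phiP _) _.
  exact: (dg.1.2 a _ _ (phiP u) (phiP v)).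
- by move=> v; exact: dg.2.
- by move=> v r /g0g; exact: fct (phiP v).
Qed.

End HahnBanach.

(** * Separation in locally convex spaces *)

Lemma continuous_uncurried_comp (S T U W : topologicalType) (f : S -> T) (g : S -> U)
    (h : T * U -> W) : continuous f -> continuous g -> continuous h ->
  continuous (fun x => h (f x, g x)).
Proof.
move=> cf cg ch x; apply: (continuous_comp (f := fun x => (f x, g x))); last exact: ch.
exact: cvg_pair (cf x) (cg x).
Qed.

Section LocallyConvex.
Variables (R : realType) (V : lmodType R) (t : Topological V).
Hypothesis lct : locally_convex_topology t.
Local Notation E := (Topological.Pack t).

Lemma lct_line_continuous (a b : V) : continuous (fun s : R^o => (a + s *: b : E)).
Proof.
have [cadd cscale _] := lct.
pose sb (s : R^o) : E := s *: b.
apply: (@continuous_uncurried_comp _ E E E (fun=> a) sb _ (@cst_continuous _ _ _) _ cadd).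
exact: (continuous_uncurried_comp (fun x => @cvg_id _ (nbhs x))
  (@cst_continuous _ _ (b : E)) cscale).
Qed.

Lemma lct_affine_continuous (a : R) (b : V) : continuous (fun v : E => (a *: (v : V) + b : E)).
Proof.
have [cadd cscale _] := lct.
pose av (v : E) : E := a *: (v : V).
apply: (@continuous_uncurried_comp _ E E E av (fun=> b) _ _ (@cst_continuous _ _ _) cadd).
exact: (@continuous_uncurried_comp E R^o E E (fun=> a) id _
  (@cst_continuous _ _ _) (fun x => @cvg_id _ (nbhs x)) cscale).
Qed.

Lemma lct_nbhs_convex (z : V) (W : set V) : nbhs (z : E) W ->
  exists W' : set V, [/\ nbhs (z : E) W', convex_set (W' : set (convex_lmodType V))
    & W' `<=` W].
Proof.
have [_ _ [B cB [Bo Bb]]] := lct => /(Bb (z : E))[W' [BW' W'z] W'W].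
exists W'; split => //; first exact/open_nbhs_nbhs/(conj (Bo _ BW')).
by apply: cB; exact/mem_set.
Qed.

Lemma bounded_scalar_continuous (phi : V -> R^o) (U : set V) : scalar phi ->
  nbhs (0 : E) U -> (forall v, U v -> phi v <= 1) ->
  continuous (phi : E -> R^o).
Proof.
move=> lphi U0 phiU v.
have phiZ a u : phi (a *: u) = a * phi u.
  have := lphi a u 0; rewrite addr0 => ->.
  by have := lphi (-1) 0 0; rewrite scaler0 addr0; lra.
apply/cvgrPdist_le => e e0.
have near_affine (a : R) : \forall w \near (v : E), U (a *: w + - (a *: v)).
  have := @lct_affine_continuous a (- (a *: v)) v.
  by rewrite /continuous_at subrr => /(_ _ U0).
near=> w.
have h1 : U (e^-1 *: w - (e^-1 *: v)) by near: w; exact: near_affine.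
have h2 : U (- e^-1 *: w - (- e^-1 *: v)) by near: w; exact: near_affine.
move: h1 h2 => /phiU + /phiU.
rewrite -!scalerBr !phiZ.
have -> : phi (w - v) = phi w - phi v.
  by rewrite -scaleN1r addrC lphi; ring.
rewrite mulNr -mulrN !(mulrC e^-1) !ler_pdivrMr// !mul1r ler_norml => h1 h2.
by apply/andP; split; lra.
Unshelve. all: by end_near. Qed.

(** Apply Hahn-Banach to the functional on the span of [M] and [z] that vanishes
    on [M] and has value 1 at [z], with [U = z - W] for a convex neighbourhood
    [W] of [z] disjoint from [M].  It is at most 1 on [U]: if [m + r *: z] is in
    [U] with [1 < r], then [z] and [(1 - r) *: z - m] are points of [W] with a
    convex combination in [M]. *)
Theorem closed_linear_separation (M : set V) (z : V) : linear_set M ->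
  ~ closure_for t M z ->
  exists phi : V -> R^o, [/\ scalar phi, continuous (phi : E -> R^o),
    forall m, M m -> phi m = 0 & phi z = 1].
Proof.
move=> lM clz.
have [W0 [zW0 W0M]] : exists W, nbhs (z : E) W /\ ~ (M `&` W !=set0).
  by move: clz => /existsNP[W /not_implyP[? ?]]; exists W.
have [W [zW cW WW0]] := lct_nbhs_convex zW0.
have {W0M} WM m : M m -> ~ W m by move=> Mm Wm; apply: W0M; exists m; split=> //; exact: WW0.
pose U := [set u : V | W (z - u)].
have Unear : nbhs (0 : E) U.
  have := @lct_affine_continuous (-1) z (0 : E); rewrite /continuous_at scaler0 add0r.
  move=> /(_ _ zW); rewrite /= nbhs_simpl /=; apply: (@filterS _ _ (@nbhs_filter E 0)) => u.
  by rewrite /= scaleN1r addrC.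
have U0 : U 0 by exact: (nbhs_singleton Unear).
have convU : convex_set (U : set (convex_lmodType V)).
  apply/convex_setP => x y a Ux Uy a0 a1; rewrite /U /=.
  rewrite (_ : _ - _ = a *: (z - x) + (1 - a) *: (z - y)).
    by move/convex_setP : cW; exact.
  rewrite !scalerBr addrACA -scalerDl -opprD.
  by rewrite [a + _](_ : _ = 1) ?scale1r//; lra.
have absU v : exists2 e : R, 0 < e & U (e *: v).
  have := @lct_line_continuous 0 v 0; rewrite /continuous_at scale0r addr0.
  move=> /(_ _ Unear); rewrite /= nbhs_simpl /= => /nbhs_ballP[e /= e0 eU].
  exists (e / 2); first by rewrite divr_gt0.
  rewrite -[_ *: _]add0r; apply: eU.
  rewrite /ball /= sub0r normrN gtr0_norm ?divr_gt0//.
  by rewrite ltr_pdivrMr// ltr_pMr// ltr1n.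
pose g0 := [set p : V * R^o | M (p.1 - p.2 *: z)].
have [|phi [lphi phiU phig]] := @hahn_banach_convex _ _ U U0 convU absU g0.
  split.
    split; first by rewrite /g0 /= scale0r subr0; exact: lM.1.
    move=> a [u r] [v s]; rewrite /g0 /= => Mu Mv.
    rewrite (_ : _ - _ = a *: (u - r *: z) + (v - s *: z)); first exact: lM.2.
    by rewrite scalerDl opprD scalerBr scalerA addrACA.
  move=> v r; rewrite /g0 /= => Mv Uv; rewrite leNgt; apply/negP => r1.
  have [m0 m1] : 0 <= r^-1 /\ r^-1 <= 1.
    by rewrite invr_ge0 invf_le1; lra.
  (* the combination with weights [1 - r^-1] and [r^-1] that cancels [z] *)
  pose m := - r^-1 *: (v - r *: z).
  apply: (WM m); first exact: linear_setZ.
  rewrite (_ : m = r^-1 *: (z - v) + (1 - r^-1) *: z).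
    by move/convex_setP : cW; apply=> //; exact: (nbhs_singleton zW).
  rewrite /m scaleNr -scalerN opprB !scalerBr scalerA mulVf; last by lra.
  by rewrite scale1r scalerBl scale1r [RHS]addrC addrA subrK.
exists phi; split => //.
- exact: bounded_scalar_continuous Unear phiU.
- by move=> m Mm; apply: phig; rewrite /g0 /= scale0r subr0.
- by apply: phig; rewrite /g0 /= scale1r subrr; exact: lM.1.
Qed.

End LocallyConvex.

(** * Orthogonality, Fitzpatrick functions and monotone extensions *)

Section Duality.
Variables (R : realType) (Y : normedModType R).
Local Notation Z := (topdual Y * Y)%type.
Implicit Types (z w : Z) (A B M : set Z) (f : Z -> \bar R).

Lemma zdotC z w : zdot z w = zdot w z.
Proof. by rewrite /zdot addrC. Qed.

Lemma zdotPl (a : R) z z' w : zdot (a *: z + z') w = a * zdot z w + zdot z' w.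
Proof.
rewrite /zdot.
have -> : (a *: z + z').1 w.2 = a * z.1 w.2 + z'.1 w.2 by [].
by rewrite (@topdual_scalar _ _ w.1 a z.2 z'.2) mulrDr addrACA.
Qed.

Lemma zdot0 w : zdot 0 w = 0.
Proof. by have := zdotPl (-1) 0 0 w; rewrite scaler0 addr0; lra. Qed.

Lemma zdotZl (a : R) z w : zdot (a *: z) w = a * zdot z w.
Proof. by have := zdotPl a z 0 w; rewrite zdot0 !addr0. Qed.

Lemma zdotDl z z' w : zdot (z + z') w = zdot z w + zdot z' w.
Proof. by have := zdotPl 1 z z' w; rewrite scale1r mul1r. Qed.

Lemma zdotZr (a : R) z w : zdot w (a *: z) = a * zdot w z.
Proof. by rewrite zdotC zdotZl zdotC. Qed.

Lemma zdotDr z z' w : zdot w (z + z') = zdot w z + zdot w z'.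
Proof. by rewrite zdotC zdotDl !(zdotC w). Qed.

Lemma zdotNr z w : zdot w (- z) = - zdot w z.
Proof. by rewrite -scaleN1r zdotZr mulN1r. Qed.

Lemma couplingE z : coupling z = zdot z z / 2.
Proof. by rewrite /zdot -/(coupling z); lra. Qed.

Lemma couplingD z w : coupling (z + w) = coupling z + zdot z w + coupling w.
Proof. by rewrite !couplingE !zdotDl !zdotDr (zdotC w z); lra. Qed.

Lemma couplingZ (a : R) z : coupling (a *: z) = a ^+ 2 * coupling z.
Proof. by rewrite !couplingE !zdotZl !zdotZr; ring. Qed.

Lemma couplingN z : coupling (- z) = coupling z.
Proof. by rewrite -scaleN1r couplingZ sqrrN expr1n mul1r. Qed.

Lemma coupling0 : coupling (0 : Z) = 0.
Proof. by rewrite couplingE zdot0 mul0r. Qed.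

Lemma linear_subspaceP A : linear_subspace A <-> linear_set A.
Proof.
split=> [[/set_mem A0 h]|[A0 h]]; split; rewrite ?inE//.
  by move=> a u v Au Av; apply/set_mem/h; exact/mem_set.
by move=> a u v /set_mem Au /set_mem Av; apply/mem_set/h.
Qed.

Definition perp A : set Z := [set z | forall w, A w -> zdot z w = 0].

Lemma linear_perp A : linear_set (perp A).
Proof.
split=> [w _|a u v Au Av w Aw]; first exact: zdot0.
by rewrite zdotPl Au// Av// mulr0 addr0.
Qed.

Lemma perpS A B : A `<=` B -> perp B `<=` perp A.
Proof. by move=> AB z Bz w /AB; exact: Bz. Qed.

Lemma sub_perp2 A : A `<=` perp (perp A).
Proof. by move=> z Az w Aw; rewrite zdotC Aw. Qed.

Lemma perp3 A : perp (perp (perp A)) = perp A.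
Proof. by apply/seteqP; split; [exact/perpS/sub_perp2|exact: sub_perp2]. Qed.

Lemma skew_sub_perp A : linear_set A -> skew_set A -> A `<=` perp A.
Proof.
move=> lA sA z Az w Aw.
have := couplingD z w.
by rewrite (sA _ Az) (sA _ Aw) (sA (z + w)); [lra|exact: linear_setD].
Qed.

Lemma sub_perp_skew A : A `<=` perp A -> skew_set A.
Proof. by move=> AA z Az /=; rewrite couplingE (AA _ Az)// mul0r. Qed.

Lemma neg_setK A : neg_set (neg_set A) = A.
Proof. by apply/seteqP; split => -[x y] /=; rewrite /neg_set /= opprK. Qed.

Lemma neg_setS A B : A `<=` B -> neg_set A `<=` neg_set B.
Proof. by move=> AB z; exact: AB. Qed.

Lemma zdot_neg z w : zdot (z.1, - z.2) (w.1, - w.2) = - zdot z w.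
Proof.
have opp (mu : topdual Y) (y : Y) : mu (- y) = - mu y.
  have := @topdual_scalar _ _ mu (-1) y 0; rewrite addr0 scaleN1r => ->.
  by have := @topdual_scalar _ _ mu (-1) 0 0; rewrite scaler0 addr0; lra.
by rewrite /zdot /= !opp; lra.
Qed.

Lemma coupling_neg z : coupling (z.1, - z.2) = - coupling z.
Proof. by rewrite couplingE zdot_neg couplingE; lra. Qed.

Lemma linear_neg A : linear_set A -> linear_set (neg_set A).
Proof.
move=> lA; split; first by rewrite /neg_set /= oppr0; exact: lA.1.
move=> a z w Az Aw; rewrite /neg_set /=.
have -> : (a *: z.1 + w.1, - (a *: z.2 + w.2)) = a *: (z.1, - z.2) + (w.1, - w.2).
  by congr (_, _); rewrite /= opprD scalerN.
exact: lA.2.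
Qed.

Lemma perp_neg A : perp (neg_set A) = neg_set (perp A).
Proof.
have h B z : perp B (z.1, - z.2) -> perp (neg_set B) z.
  by move=> Bz w Bw; have := Bz _ Bw; rewrite zdot_neg; lra.
apply/seteqP; split => z; last exact: h.
move=> Az; rewrite /neg_set /= -[A]neg_setK; apply: h.
by rewrite /= opprK -surjective_pairing.
Qed.

Lemma indicator_in A z : A z -> indicator_fun R A z = 0%E.
Proof. by move=> Az; rewrite /indicator_fun mem_set. Qed.

Lemma indicator_notin A z : ~ A z -> indicator_fun R A z = +oo%E.
Proof. by move=> Az; rewrite /indicator_fun memNset. Qed.

Lemma ereal_sup_line (S : set (\bar R)) (d : R) : d != 0 ->
  (forall k : R, S (k * d)%:E) -> ereal_sup S = +oo%E.
Proof.
move=> d0 Sd; apply/eqyP => M _; apply: ereal_sup_ubound.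
by rewrite -[M](divfK d0); exact: Sd.
Qed.

Lemma perpN A z : ~ perp A z -> exists2 w, A w & zdot z w != 0.
Proof. by move=> /existsNP[w /not_implyP[Aw /eqP zw]]; exists w. Qed.

Lemma conjugate_indicator A : linear_set A ->
  conjugate (indicator_fun R A) = indicator_fun R (perp A).
Proof.
move=> lA; apply/funext => z; have [Az|Az] := pselect (perp A z).
  rewrite indicator_in//; apply/eqP; rewrite eq_le; apply/andP; split.
    apply: ge_ereal_sup => _ [w _ <-]; have [Aw|Aw] := pselect (A w).
      by rewrite indicator_in// Az// sube0.
    by rewrite indicator_notin// leNye.
  apply: ereal_sup_ubound; exists 0 => //.
  by rewrite (indicator_in lA.1) sube0 zdotC zdot0.
rewrite indicator_notin//; have [w Aw zw] := perpN Az.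
apply: ereal_sup_line zw _ => k; exists (k *: w) => //.
by rewrite indicator_in ?sube0 ?zdotZr//; exact: linear_setZ.
Qed.

Lemma fitzpatrick_skew A : linear_set A -> skew_set A ->
  fitzpatrick A = indicator_fun R (perp A).
Proof.
move=> lA sA; apply/funext => z.
have [Az|Az] := pselect (perp A z).
  rewrite indicator_in//; apply/eqP; rewrite eq_le; apply/andP; split.
    by apply: ge_ereal_sup => _ [w Aw <-]; rewrite sA// Az// subr0.
  apply: ereal_sup_ubound; exists 0; first exact: lA.1.
  by rewrite coupling0 subr0 zdotC zdot0.
rewrite indicator_notin//; have [w Aw zw] := perpN Az.
apply: ereal_sup_line zw _ => k; exists (k *: w); first exact: linear_setZ.
by rewrite sA ?subr0 ?zdotZr//; exact: linear_setZ.
Qed.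

Lemma fitzpatrick_conj_skew A : linear_set A -> skew_set A ->
  fitzpatrick_conj A = indicator_fun R (perp (perp A)).
Proof.
move=> lA sA; rewrite /fitzpatrick_conj fitzpatrick_skew//.
by rewrite conjugate_indicator//; exact: linear_perp.
Qed.

Lemma coincidence_indicator A :
  coincidence (indicator_fun R A) = A `&` [set z | coupling z = 0].
Proof.
apply/seteqP; split => z; rewrite /coincidence /=.
  have [Az|Az] := pselect (A z); last by rewrite indicator_notin.
  by rewrite indicator_in// => -[].
by move=> [Az ->]; rewrite indicator_in.
Qed.

Lemma monotone_linear A : linear_set A ->
  (forall z, A z -> 0 <= coupling z) -> monotone_set A.
Proof. by move=> lA h z w Az Aw; apply: h; exact: linear_setB. Qed.

(** Otherwise some multiple [k *: w] of an element of [A] makes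
    [coupling (z - k *: w) = coupling z - k * zdot z w] negative. *)
Lemma monotone_extension_perp A M : linear_set A -> skew_set A ->
  monotone_set M -> A `<=` M -> M `<=` perp A.
Proof.
move=> lA sA mM AM z Mz w Aw; apply/eqP; apply: contrapT => /negP d0.
pose k := (coupling z + 1) / zdot z w.
have := mM _ _ Mz (AM _ (linear_setZ lA k Aw)).
rewrite -scaleNr couplingD zdotZr couplingZ (sA _ Aw) mulr0 addr0.
by rewrite mulNr divfK//; lra.
Qed.

(** A functional vanishing on [A] and equal to 1 at a point outside the closure
    is [zdot] against an element of [perp A], by compatibility. *)
Lemma closure_perp (t : Topological Z) A : compatible_topology t ->
  linear_set A -> closure_for t A = perp (perp A).
Proof.
move=> [lct ct] lA; apply/seteqP; split => z.
  move=> clz w Aw; apply/eqP; apply: contrapT => /negP d0.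
  have [_ cw] := (ct (fun x => zdot x w)).2 (ex_intro _ w erefl).
  have : nbhs (z : Topological.Pack t) [set z' | zdot z' w != 0].
    have /cvgrPdist_lt/(_ `|zdot z w|) := cw z; rewrite normr_gt0 => /(_ d0).
    apply: (@filterS _ _ (@nbhs_filter (Topological.Pack t) z)) => z' /=.
    by apply: contraTneq => ->; rewrite subr0 ltxx.
  by move=> /clz[a [Aa /= /eqP]]; apply; rewrite zdotC Aw.
move=> Az; apply: contrapT => /(closed_linear_separation lct lA)[phi [lphi cphi phi0 phi1]].
have [w phiE] := (ct phi).1 (conj lphi cphi).
have := Az w; rewrite -[zdot z w]/((fun x => zdot x w) z) -phiE phi1 => h.
have /h : perp A w by move=> a Aa; rewrite zdotC; have := phi0 _ Aa; rewrite phiE.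
by move/eqP; rewrite oner_eq0.
Qed.

Lemma closed_perp2 (t : Topological Z) A : compatible_topology t ->
  closed_for t (perp (perp A)).
Proof.
move=> ct; rewrite -[perp (perp A)](_ : closure_for t (perp (perp A)) = _).
  exact: closed_closure.
by rewrite closure_perp ?perp3//; exact: linear_perp.
Qed.

Lemma le0_of_small_multiples (a b : R) :
  (forall s, 0 < s -> s < 1 -> a + s * b <= 0) -> a <= 0.
Proof.
move=> h; rewrite leNgt; apply/negP => a0.
have d0 : 0 < 2 * (a + `|b|) by have := normr_ge0 b; lra.
have bn := ler_norm (- b); rewrite normrN in bn.
have /h : 0 < a / (2 * (a + `|b|)) by rewrite divr_gt0.
have s1 : a / (2 * (a + `|b|)) < 1 by rewrite ltr_pdivrMr//; have := normr_ge0 b; lra.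
move=> /(_ s1); apply/negP; rewrite -ltNge.
have : a / (2 * (a + `|b|)) * - b <= a / (2 * (a + `|b|)) * `|b|.
  by rewrite ler_pM2l// divr_gt0.
have : a / (2 * (a + `|b|)) * `|b| <= a / 2.
  rewrite mulrAC ler_pdivrMr//.
  have := normr_ge0 b; nra.
by rewrite mulrN; lra.
Qed.

(** On the segment from [a] to [w] the convex function [f] is above the
    coupling and equal to it at [a]; comparing the slopes at [a] gives the
    inequality.  It says that [f] is above the Fitzpatrick function of its
    coincidence set. *)
Lemma convex_above_coupling f a w : convex_efun f ->
  (forall z, (coupling z)%:E <= f z)%E ->
  f a = (coupling a)%:E -> ((zdot a w - coupling a)%:E <= f w)%E.
Proof.
move=> cf fc fa; case fw : (f w) => [r||]; [|by rewrite leey|by have := fc w; rewrite fw].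
rewrite lee_fin -subr_le0.
apply: (@le0_of_small_multiples _ (coupling w - zdot a w + coupling a)) => s s0 s1.
have := le_trans (fc _) (cf w a s s0 s1).
rewrite fa fw -!EFinM -EFinD lee_fin couplingD !couplingZ zdotZl zdotZr (zdotC w a) => h.
rewrite -(pmulr_rle0 _ s0); nra.
Qed.

End Duality.

(** * Skew subspaces with nonnegative coupling on the orthogonal *)

Section SemicontinuityOnLines.
Variables (R : realType) (V : lmodType R) (t : Topological V) (f : V -> \bar R).
Hypotheses (lct : locally_convex_topology t) (lf : lsc_for t f).

Lemma lsc_line (a b : V) (s0 x : R) : (x%:E < f (a + s0 *: b))%E ->
  exists2 d : R, 0 < d & forall s, `|s - s0| < d -> (x%:E < f (a + s *: b))%E.
Proof.
move=> /lf[W Wz fW]; have := lct_line_continuous lct Wz.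
move=> /nbhs_ballP[d /= d0 dW]; exists d => // s sd; apply/fW/dW.
by rewrite /ball /= distrC.
Qed.

(** Moving from [w] in the direction [l] is a limit of convex combinations of
    [w] with the points [s^-1 *: l], at which [f] is at most 0. *)
Lemma lsc_convex_translate (w l : V) (r : R) : convex_efun f ->
  (forall s : R, f (s *: l) <= 0)%E -> (forall v, f v != -oo%E) ->
  f w = r%:E -> (f (w + l) <= r%:E)%E.
Proof.
move=> cf fl fNy fw; rewrite leNgt; apply/negP => rlt.
have [x [rx xf]] : exists x : R, r < x /\ (x%:E < f (w + l))%E.
  move: rlt; case: (f (w + l)) => [y||//]; rewrite ?lte_fin => ry.
    by exists ((r + y) / 2); rewrite lte_fin; split; lra.
  by exists (r + 1); rewrite ltry ltrDl.
have h : (x%:E < f ((w + l) + 0 *: (- w)))%E by rewrite scale0r addr0.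
have [d d0 dP] := lsc_line h.
clear h xf rlt.
(* so small that [dP] applies to [w + l - s *: w] and that [(1 - s) * r < x] *)
pose s := Num.min (d / 2) (Num.min (1 / 2) ((x - r) / (2 * (`|r| + 1)))).
have s0 : 0 < s.
  rewrite !lt_min; apply/and3P; split; [lra|lra|].
  by rewrite divr_gt0 ?subr_gt0//; have := normr_ge0 r; lra.
have s1 : s < 1 by rewrite !gt_min; apply/orP; right; apply/orP; left; lra.
have sd : s < d by rewrite gt_min; apply/orP; left; lra.
have := dP s; rewrite subr0 gtr0_norm// => /(_ sd).
rewrite (_ : _ + s *: _ = s *: (s^-1 *: l) + (1 - s) *: w); last first.
  by rewrite scalerA mulfV ?gt_eqF// !(scale1r, scalerBl) scalerN [w + l]addrC addrA.
move=> xs; have := lt_le_trans xs (cf _ w _ s0 s1); rewrite fw.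
have fs0 : (s%:E * f (s^-1 *: l) <= 0)%E by rewrite mule_ge0_le0// lee_fin ltW.
move=> /lt_le_trans/(_ (leeD2r _ fs0)); rewrite add0e -EFinM lte_fin.
have : s <= (x - r) / (2 * (`|r| + 1)) by rewrite !ge_min lexx !orbT.
have r0 := normr_ge0 r.
rewrite ler_pdivlMr; last by lra.
have := ler_norm (- r); rewrite normrN; nra.
Qed.

End SemicontinuityOnLines.

Section SkewSubspace.
Variables (R : realType) (Y : normedModType R).
Local Notation Z := (topdual Y * Y)%type.
Variables (A : set Z) (u : Z).
Hypotheses (lA : linear_set A) (sA : skew_set A).

Lemma perp2_sub_perp : perp (perp A) `<=` perp A.
Proof. exact/perpS/skew_sub_perp. Qed.

Lemma skew_perp2 : skew_set (perp (perp A)).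
Proof. by apply: sub_perp_skew; rewrite perp3; exact: perp2_sub_perp. Qed.

Lemma class_R_indicator (t : Topological Z) : compatible_topology t ->
  class_R (indicator_fun R (perp (perp A))).
Proof.
set L := perp (perp A).
have indNy z : indicator_fun R L z != -oo%E.
  by have [?|?] := pselect (L z); [rewrite indicator_in|rewrite indicator_notin].
have ind0 z : (0 <= indicator_fun R L z)%E.
  by have [?|?] := pselect (L z); [rewrite indicator_in|rewrite indicator_notin].
move=> ct; split.
- by split=> //; exists 0; rewrite indicator_in//; exact: (linear_perp _).1.
- move=> z w a a0 a1.
  have lL := linear_perp (perp A).
  have [Lz|Lz] := pselect (L z); last first.
    rewrite (indicator_notin Lz) gt0_muley ?lte_fin// addye ?leey//.
    by rewrite gt_eqF// (lt_le_trans _ (mule_ge0 _ _))// lee_fin subr_ge0 ltW.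
  have [Lw|Lw] := pselect (L w); last first.
    rewrite (indicator_notin Lw) gt0_muley ?lte_fin ?subr_gt0// addey ?leey//.
    by rewrite gt_eqF// (lt_le_trans _ (mule_ge0 _ _))// lee_fin ltW.
  rewrite !indicator_in ?mule0 ?adde0//.
  by apply: (linear_setD lL) => //; exact: (linear_setZ lL).
- exists t => // z a az; have [Lz|Lz] := pselect (L z).
    exists setT;
      first exact: (@filterT _ _ (@nbhs_filter (Topological.Pack t) z)).
    by move=> y _; rewrite (lt_le_trans az)// indicator_in.
  exists (~` L); last by move=> y Ly; rewrite indicator_notin// ltry.
  have oL : @open (Topological.Pack t) (~` L).
    by rewrite openC; exact: closed_perp2.
  exact: open_nbhs_nbhs.
- move=> z; have [Lz|Lz] := pselect (L z); last by rewrite indicator_notin// leey.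
  by rewrite indicator_in// skew_perp2.
Qed.

Lemma coincidence_perp2 : coincidence (indicator_fun R (perp (perp A))) = perp (perp A).
Proof.
by rewrite coincidence_indicator; apply/setIidPl; exact: skew_perp2.
Qed.

Lemma representable_perp2 (t : Topological Z) : compatible_topology t ->
  representable (perp (perp A)).
Proof.
move=> ct; exists (indicator_fun R (perp (perp A))); first exact: class_R_indicator ct.
by rewrite coincidence_perp2.
Qed.

(** [f] vanishes on [A], so it is at most 0 on the closure of [A], where the
    coupling vanishes. *)
Lemma representable_skew_closed : representable A -> A = perp (perp A).
Proof.
move=> [f [_ _ [t ct lscf] fc] Af].
apply/seteqP; split; first exact: sub_perp2.
move=> z Lz; suff : f z = (coupling z)%:E by rewrite Af.
apply/eqP; rewrite eq_le fc andbT (skew_perp2 Lz) leNgt; apply/negP => f0.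
have [W Wz fW] := lscf z 0 f0.
have clz : closure_for t A z by rewrite closure_perp.
have [a [Aa Wa]] := clz _ Wz.
have := fW _ Wa; have : f a = (coupling a)%:E by rewrite Af in Aa.
by rewrite (sA Aa) => ->; rewrite ltxx.
Qed.

(** [coupling_square] says that the coupling has rank one on [perp A]: it is the
    square of the coordinate [zdot u w / 2], which is 1 at [u]. *)
Hypotheses (Au : perp A u) (cu : coupling u = 1)
  (coupling_square : forall w, perp A w -> 4 * coupling w = zdot u w ^+ 2).

Lemma perp_coupling_ge0 z : perp A z -> 0 <= coupling z.
Proof. by move/coupling_square => h; have := sqr_ge0 (zdot u z); rewrite -h; lra. Qed.

Lemma monotone_perp : monotone_set (perp A).
Proof. exact: (monotone_linear (linear_perp A) perp_coupling_ge0). Qed.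

(** An isotropic vector of [perp A] is orthogonal to [u], hence by polarization
    to all of [perp A]. *)
Lemma perp2P : perp (perp A) = perp A `&` [set z | coupling z = 0].
Proof.
apply/seteqP; split => z.
  by move=> Lz; split; [exact: perp2_sub_perp|exact: skew_perp2].
move=> [Az /= cz] w Aw.
have zu : zdot u z = 0.
  by have := coupling_square Az; rewrite cz mulr0 => /esym/eqP; rewrite sqrf_eq0 => /eqP.
have := coupling_square (linear_setD (linear_perp A) Az Aw).
by rewrite couplingD cz zdotDr zu !add0r -coupling_square//; lra.
Qed.

Lemma not_perp2_u : ~ perp (perp A) u.
Proof. by move=> /skew_perp2; rewrite /= cu; lra. Qed.

Lemma maximal_extension_perp B : A `<=` B -> B `<=` perp A -> forall M,
  maximal_monotone_extension B M <-> M = perp A.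
Proof.
move=> AB BN M; split=> [[[mM maxM] BM]|->].
  apply/esym/maxM; first exact: monotone_perp.
  by apply: monotone_extension_perp => //; exact: subset_trans BM.
split=> //; split; first exact: monotone_perp.
move=> C mC NC; apply/seteqP; split => //.
apply: monotone_extension_perp => //; apply: subset_trans NC.
exact: subset_trans BN.
Qed.

Lemma unique_monotone_perp B : A `<=` B -> B `<=` perp A -> unique_monotone B.
Proof.
move=> AB BN; split; first by move=> z w Bz Bw; apply: monotone_perp; exact: BN.
exists (perp A); split; first exact/maximal_extension_perp.
by move=> M /(maximal_extension_perp AB BN).
Qed.

Lemma not_maximal_sub_perp2 B : B `<=` perp (perp A) -> ~ maximal_monotone B.
Proof.
move=> BL [_ /(_ _ monotone_perp)] h; apply/not_perp2_u/(BL).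
by rewrite -h//; apply: subset_trans BL _; exact: perp2_sub_perp.
Qed.

Lemma not_NI_skew : ~ NI A.
Proof.
move=> /(_ u); rewrite fitzpatrick_skew// indicator_in// cu lee_fin.
by rewrite ler10.
Qed.

(** Since [f] is infinite outside [perp A] and above the coupling
    [(zdot u w / 2) ^+ 2], the supremum defining the conjugate at [u] is at most
    1, hence equal to 1.  For a point [w] at which it is nearly
    attained, [g = zdot u w / 2] and [f w] are close to 1.  As [g *: u - w] is in
    [perp (perp A)], where [f] vanishes, [f (g *: u)] is at most [f w]. *)
Lemma not_dual_representable_perp2 : ~ dual_representable (perp (perp A)).
Proof.
move=> [f [[[fNy _] cf [t [lct _] lf] fc] fconj] Lf].
have lL := linear_perp (perp A).
have fL z : perp (perp A) z -> f z = 0%E.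
  by move=> Lz; have := Lz; rewrite [X in X z]Lf /coincidence /= skew_perp2.
have fN w : f w != +oo%E -> perp A w.
  move=> fw; apply: contrapT => nAw; move: fw => /eqP; apply.
  have [a Aa wa] := perpN nAw.
  apply/eqyP => M _.
  have La : perp (perp A) ((M / zdot w a) *: a).
    by apply: (linear_setZ lL); exact: sub_perp2.
  have fLa := fL _ La; have c0 := skew_perp2 La.
  have := convex_above_coupling w cf fc (a := (M / zdot w a) *: a).
  rewrite c0 subr0 => /(_ fLa).
  by rewrite zdotZl (zdotC a) divfK.
apply: not_perp2_u; rewrite Lf /coincidence /= cu.
apply/eqP; rewrite eq_le -{2}cu fc andbT leNgt; apply/negP => fu.
have [x [x1 xf]] : exists x : R, 1 < x /\ (x%:E < f u)%E.
  move: fu; case: (f u) => [y||//]; rewrite ?lte_fin => ry.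
    by exists ((1 + y) / 2); rewrite lte_fin; split; lra.
  by exists 2; rewrite ltry ltr1n.
have h : (x%:E < f (0 + 1 *: u)%R)%E by rewrite scale1r add0r.
have [d d0 dP] := lsc_line lct lf h.
clear h xf fu.
pose k := Num.min 1 ((x - 1) / 4); pose e := Num.min ((d / 2) ^+ 2) (k ^+ 2).
have k0 : 0 < k by rewrite lt_min; apply/andP; split; lra.
have [k1 kx] : k <= 1 /\ k <= (x - 1) / 4 by rewrite !ge_min !lexx orbT.
have e0 : 0 < e by rewrite lt_min !exprn_gt0//; lra.
have : ((1 - e)%:E < conjugate f u)%E.
  by rewrite (lt_le_trans _ (fconj u))// cu lte_fin; lra.
move=> /ereal_sup_gt[_ [w _ <-]].
have {}fc' := fc w; case fw : (f w) fc' => [r||] fc'; [|by []|by []].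
rewrite -EFinB lte_fin => hw.
have Aw : perp A w by apply: fN; rewrite fw.
pose g := zdot u w / 2.
have cw : coupling w = g ^+ 2 by have := coupling_square Aw; rewrite /g; nra.
have gr : g ^+ 2 <= r by rewrite -cw -lee_fin.
have hg : 2 * g - r > 1 - e by rewrite /g; lra.
have Ll : perp (perp A) (g *: u - w).
  rewrite perp2P; split.
    by apply: (linear_setB (linear_perp A)) => //; exact: (linear_setZ (linear_perp A)).
  rewrite /= couplingD zdotNr zdotZl couplingZ couplingN cu cw /g; nra.
have : (f (g *: u) <= r%:E)%E.
  rewrite -[g *: u](subrK w) addrC; apply: (lsc_convex_translate lct lf) => //.
  by move=> s; rewrite fL//; exact: (linear_setZ lL).
(* [g ^+ 2 <= r < 2 * g - 1 + e] *)
have ge : (g - 1) ^+ 2 < e by nra.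
have gd : `|g - 1| < d.
  have : (g - 1) ^+ 2 < (d / 2) ^+ 2 by rewrite (lt_le_trans ge)// ge_min lexx.
  by rewrite -real_normK ?num_real// ltr_pXn2r ?nnegrE//; lra.
have gk : `|g - 1| < k.
  have : (g - 1) ^+ 2 < k ^+ 2 by rewrite (lt_le_trans ge)// ge_min lexx orbT.
  by rewrite -real_normK ?num_real// ltr_pXn2r ?nnegrE//; exact: ltW.
have ek : e <= k ^+ 2 by rewrite ge_min lexx orbT.
have := dP g gd; rewrite add0r => /lt_le_trans/[apply]; rewrite lte_fin.
have := ler_norm (g - 1).
nra.
Qed.

End SkewSubspace.

(** * The weak topology is compatible with the duality *)

Section SupInitial.
Variables (R : realType) (S : choiceType) (I : eqType) (f : I -> S -> R^o).
Local Notation T := (sup_topology (fun i => Topological.on (initial_topology (f i)))).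

Lemma sup_initial_continuous i : continuous (f i : T -> R^o).
Proof.
move=> x; have [h _] := @cvg_sup S I (fun i => Topological.on (initial_topology (f i))) _ x
  (nbhs_filter (x : T)).
exact: cvg_comp (h cvg_id i) (@initial_continuous _ _ (f i) x).
Qed.

(** The sets on the right form a filter, which converges for each of the initial
    topologies, hence for their supremum. *)
Lemma nbhs_sup_initial_seq (x : T) (A : set S) : nbhs x A -> exists s : seq I,
  exists2 e : R, 0 < e &
    forall x', (forall i, i \in s -> `|f i x' - f i x| < e) -> A x'.
Proof.
pose F : set_system S := [set A | exists s : seq I, exists2 e : R, 0 < e &
  forall x', (forall i, i \in s -> `|f i x' - f i x| < e) -> A x'].
have FF : Filter F.
  split; first by exists [::], 1.
    move=> P Q [s [e e0 sP]] [s' [e' e'0 sQ]].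
    exists (s ++ s'), (Num.min e e'); first by rewrite lt_min e0.
    move=> x' h; split.
      by apply: sP => i si; have := h i; rewrite mem_cat si lt_min => /(_ isT) /andP[].
    by apply: sQ => i si; have := h i; rewrite mem_cat si orbT lt_min => /(_ isT) /andP[].
  by move=> P Q PQ [s [e e0 sP]]; exists s, e => // x' /sP/PQ.
suff : F --> (x : T) by apply.
apply/cvg_sup => i B [_ [[C Co <-] Cx CB]].
have /nbhs_ballP[e e0 eC] : nbhs (f i x) C by exact: open_nbhs_nbhs.
exists [:: i], e => // x' h; apply/CB/eC.
by rewrite /ball /= distrC; apply: h; rewrite inE.
Qed.

End SupInitial.

Lemma near_all_in (T : Type) (F : set_system T) (I : eqType) (s : seq I)
    (P : I -> set T) : Filter F -> (forall i, i \in s -> F (P i)) ->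
  F [set t | forall i, i \in s -> P i t].
Proof.
move=> FF; elim: s => [|i s IH] h.
  by rewrite (_ : [set _ | _] = setT) ?predeqE//; exact: filterT.
have h1 := h i (mem_head _ _).
have {IH}h2 : F [set t | forall i, i \in s -> P i t].
  by apply: IH => j js; apply: h; rewrite inE js orbT.
apply: filterS (filterI h1 h2) => t [t1 t2] j.
by rewrite inE => /predU1P[->//|]; exact: t2.
Qed.

Section SigmaTopology.
Variables (R : realType) (Y : normedModType R).
Local Notation Z := (topdual Y * Y)%type.
Local Notation E := (Topological.Pack (sigmaZ Y)).

Lemma zdot_sigma_continuous (w : Z) : continuous ((fun z => zdot z w) : E -> R^o).
Proof.
move=> z; apply: cvgD.
  apply: (continuous_comp (f := fun z : (sigmaX Y * sigmaY Y)%type => z.1)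
    (g := fun x : sigmaX Y => (x : topdual Y) w.2 : R^o)); first exact: cvg_fst.
  exact: (@sup_initial_continuous R _ _ (fun (y : Y) (x : topdual Y) => x y)).
apply: (continuous_comp (f := fun z : (sigmaX Y * sigmaY Y)%type => z.2)
  (g := fun y : sigmaY Y => w.1 (y : Y) : R^o)); first exact: cvg_snd.
exact: (@sup_initial_continuous R _ _ (fun (x : topdual Y) (y : Y) => x y)).
Qed.

Lemma nbhs_sigma (z : Z) (A : set Z) : nbhs (z : E) A -> exists ws : seq Z,
  exists2 e : R, 0 < e &
    forall z', (forall w, w \in ws -> `|zdot z' w - zdot z w| < e) -> A z'.
Proof.
move=> [[P Q] /= [Pz Qz] PQA].
have [ys [e e0 ysP]] := nbhs_sup_initial_seq (f := fun (y : Y) (x : topdual Y) => x y) Pz.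
have [xs [e' e'0 xsQ]] := nbhs_sup_initial_seq (f := fun (x : topdual Y) (y : Y) => x y) Qz.
exists ([seq ((0 : topdual Y), y) | y <- ys] ++ [seq (x, 0 : Y) | x <- xs]), (Num.min e e').
  by rewrite lt_min e0.
have ev0 (x : topdual Y) : x 0 = 0.
  by have := @topdual_scalar _ _ x (-1) 0 0; rewrite scaler0 addr0; lra.
move=> z' h; apply: (PQA z'); split => /=.
  apply: ysP => y yys; have := h (0, y).
  rewrite mem_cat map_f// => /(_ isT); rewrite lt_min => /andP[+ _].
  by rewrite /zdot /= !addr0.
apply: xsQ => x xxs; have := h (x, 0).
rewrite mem_cat orbC map_f// => /(_ isT); rewrite lt_min => /andP[_].
by rewrite /zdot /= !ev0 !add0r.
Qed.

Lemma continuous_to_sigma (T : topologicalType) (g : T -> Z) :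
  (forall w, continuous (fun t => zdot (g t) w : R^o)) -> continuous (g : T -> E).
Proof.
move=> cg t A /nbhs_sigma[ws [e e0 wsA]]; apply: filterS (fun t' => wsA (g t')) _.
apply: near_all_in => w _; have /cvgrPdist_lt/(_ e e0) := cg w t.
by apply: filterS => t'; rewrite distrC.
Qed.

Lemma sigma_locally_convex : locally_convex_topology (sigmaZ Y).
Proof.
have cfst (S T : topologicalType) : continuous (fst : S * T -> S) by move=> ?; exact: cvg_fst.
have csnd (S T : topologicalType) : continuous (snd : S * T -> T) by move=> ?; exact: cvg_snd.
split.
- apply: continuous_to_sigma => w p.
  under eq_fun do rewrite zdotDl.
  apply: (@cvgD _ R^o).
    exact: (continuous_comp (cfst E E p) (@zdot_sigma_continuous w p.1)).
  exact: (continuous_comp (csnd E E p) (@zdot_sigma_continuous w p.2)).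
- apply: continuous_to_sigma => w p.
  under eq_fun do rewrite zdotZl.
  apply: cvgM; first exact: (cfst R^o E p).
  exact: (continuous_comp (csnd R^o E p) (@zdot_sigma_continuous w p.2)).
exists [set b : set E | open b /\ convex_set (b : set (convex_lmodType Z))].
  by move=> b /set_mem[].
split=> [b []//|z A /nbhs_sigma[ws [e e0 wsA]]].
exists [set z' : Z | forall w, w \in ws -> `|zdot z' w - zdot z w| < e]; last exact: wsA.
split=> [|w _]; last by rewrite subrr normr0.
split.
  rewrite openE => z' z'ws; apply: near_all_in => w /z'ws wz'.
  have : nbhs (zdot z' w) (ball (zdot z w) e).
    by apply: open_nbhs_nbhs; split; [exact: ball_open|rewrite /ball /= distrC].
  move/(@zdot_sigma_continuous w z'); apply: (@filterS _ _ (@nbhs_filter E z')) => z''.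
  by rewrite /ball /= distrC.
apply/convex_setP => x y a xw yw a0 a1 w ww.
rewrite zdotDl !zdotZl.
have := xw w ww; have := yw w ww; rewrite !ltr_norml => /andP[? ?] /andP[? ?].
have [->|an0] := eqVneq a 0; first by rewrite subr0 mul0r mul1r add0r; apply/andP.
have ap : 0 < a by rewrite lt_neqAle eq_sym an0.
by apply/andP; split; nra.
Qed.

(** By induction on [ws]: subtracting from [phi] a multiple of the form given by
    [w] yields a functional vanishing on the common kernel of the remaining
    forms, unless the form given by [w] already vanishes there. *)
Lemma scalar_finite_kernel (ws : seq Z) (phi : Z -> R^o) : scalar phi ->
  (forall z, (forall w, w \in ws -> zdot z w = 0) -> phi z = 0) ->
  exists w, phi = fun z => zdot z w.
Proof.
elim: ws phi => [|w ws IH] phi lphi ker.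
  by exists 0; apply/funext => z; rewrite zdotC zdot0 ker.
have phiB (a : R) z z' : phi (z - a *: z') = phi z - a * phi z'.
  by rewrite addrC -scaleNr lphi mulNr addrC.
have [[v [vw0 vws]]|nv] :=
    pselect (exists v, zdot v w != 0 /\ forall w', w' \in ws -> zdot v w' = 0).
  pose c : R := phi v / zdot v w.
  have [||w' phiE] := IH (fun z => phi z - c * zdot z w).
  - by move=> a z z' /=; rewrite lphi zdotPl; ring.
  - move=> z zws; have /ker : forall w', w' \in w :: ws ->
        zdot (z - (zdot z w / zdot v w) *: v) w' = 0.
      move=> w'; rewrite -scaleNr zdotDl zdotZl inE => /predU1P[->|w'ws].
        by rewrite mulNr divfK// subrr.
      by rewrite (vws w')// mulr0 addr0 zws.
    by rewrite phiB => h; rewrite -[RHS]h /c; field.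
  exists (w' + c *: w); apply/funext => z; rewrite zdotDr zdotZr.
  by have := congr1 (@^~ z) phiE => /= <-; rewrite subrK.
apply: IH => // z zws; apply: ker => w'; rewrite inE => /predU1P[->|]; last exact: zws.
by apply/eqP; apply: contrapT => /negP zw; apply: nv; exists z.
Qed.

Theorem sigma_compatible : compatible_topology (sigmaZ Y).
Proof.
split; first exact: sigma_locally_convex.
move=> phi; split=> [[lphi cphi]|[w ->]]; last first.
  by split; [move=> a z z'; exact: zdotPl|exact: zdot_sigma_continuous].
have phiZ (a : R) z : phi (a *: z) = a * phi z.
  have := lphi a z 0; rewrite addr0 => ->.
  by have := lphi (-1) 0 0; rewrite scaler0 addr0; lra.
have phi0 : phi 0 = 0 by have := phiZ 0 0; rewrite scale0r mul0r.
have /cvgrPdist_lt/(_ 1 ltr01) := cphi (0 : Z).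
rewrite phi0 => /nbhs_sigma[ws [e e0 wsphi]].
apply: (scalar_finite_kernel (ws := ws)) => // z zws.
apply/eqP; apply: contrapT => /negP phiz0.
have := wsphi ((phi z)^-1 *: z); rewrite /= phiZ mulVf// sub0r normrN normr1 ltxx.
have : forall w, w \in ws -> `|zdot ((phi z)^-1 *: z) w - zdot 0 w| < e.
  by move=> w /zws zw; rewrite zdotZl zw mulr0 zdot0 subr0 normr0.
by move=> h /(_ h).
Qed.

End SigmaTopology.

(** * Skew subspaces with nonpositive coupling on the orthogonal *)

Section NegatedSubspace.
Variables (R : realType) (Y : normedModType R).
Local Notation Z := (topdual Y * Y)%type.
Variable A : set Z.
Hypotheses (lA : linear_set A) (sA : skew_set A)
  (coupling_le0 : forall z, perp A z -> coupling z <= 0)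
  (coupling_eq0 : forall z, perp A z -> coupling z = 0 -> perp (perp A) z).

Lemma NI_skew : NI A.
Proof.
move=> z; rewrite fitzpatrick_skew//; have [Az|Az] := pselect (perp A z).
  by rewrite indicator_in// lee_fin coupling_le0.
by rewrite indicator_notin// leey.
Qed.

Lemma monotone_perp2 : monotone_set (perp (perp A)).
Proof.
apply: monotone_linear; first exact: linear_perp.
by move=> z /(skew_perp2 lA sA) ->.
Qed.

(** [A] contains 0, so the coupling of a point of a monotone extension is
    nonnegative. *)
Lemma monotone_extension_sub_perp2 M : monotone_set M -> A `<=` M ->
  M `<=` perp (perp A).
Proof.
move=> mM AM z Mz; have Az : perp A z by exact: monotone_extension_perp Mz.
apply: coupling_eq0 => //; apply/eqP; rewrite eq_le coupling_le0//=.
by have := mM _ _ Mz (AM _ lA.1); rewrite subr0.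
Qed.

Lemma maximal_extension_perp2 M :
  maximal_monotone_extension A M <-> M = perp (perp A).
Proof.
have max : maximal_monotone (perp (perp A)).
  split=> [|B mB LB]; first exact: monotone_perp2.
  apply/seteqP; split=> //; apply: monotone_extension_sub_perp2 => //.
  exact: subset_trans (@sub_perp2 _ _ A) LB.
split=> [[[mM maxM] AM]|->]; last by split=> //; exact: sub_perp2.
apply/esym/maxM; first exact: monotone_perp2.
exact: monotone_extension_sub_perp2.
Qed.

End NegatedSubspace.

(** * Generalized limits on bounded sequences *)

Section Functionals.
Variable R : realType.
Local Notation ell1 := (ell1 R).
Local Notation linf := (linf R).
Local Notation X := (topdual linf).

Lemma bounded_seqP (y : nat -> R) (M : R) : (forall n, `|y n| <= M) ->
  (y : nat -> R^o) \in @bounded_seq R.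
Proof. by move=> yM; apply/asboolP; exists M. Qed.

Lemma topdualP (phi : linf -> R^o) (M : R) : scalar phi ->
  (forall y, `|phi y| <= M * `|y|) -> exists mu : X, forall y, mu y = phi y.
Proof.
move=> lphi phiM.
have h : phi \in @continuous_scalar R linf.
  by apply/asboolP; split=> //; apply/(scalar_continuousP lphi); exists M.
by exists (TopDual h).
Qed.

Lemma topdualD (mu : X) (y y' : linf) : mu (y + y') = mu y + mu y'.
Proof. by rewrite -[y]scale1r topdual_scalar mul1r scale1r. Qed.

Lemma topdual0 (mu : X) : mu 0 = 0.
Proof. by have := topdualD mu 0 0; rewrite addr0; lra. Qed.

Lemma topdualZ (mu : X) (a : R) (y : linf) : mu (a *: y) = a * mu y.
Proof. by have := topdual_scalar mu a y 0; rewrite topdual0 !addr0. Qed.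

Lemma topdualB (mu : X) (y y' : linf) : mu (y - y') = mu y - mu y'.
Proof. by rewrite topdualD -scaleN1r topdualZ mulN1r. Qed.

Lemma ultrafilter_bounded_cvg (U : set_system nat) (y : linf) :
  UltraFilter U -> exists l : R, y n @[n --> U] --> (l : R^o).
Proof.
move=> UU; have [M yM] := linf_bounded y.
have UT : (y @ U) `[- M, M]%classic.
  by apply: (@filterS _ U _ setT) filterT => n _; rewrite /= in_itv /= -ler_norml.
have [l [_ cll]] := @segment_compact R (- M) M _ _ UT.
exists l => B Bl; have [//|UB] := in_ultra_setVsetC (y @^-1` B) UU.
have [r [nBr Br]] := cll (~` B) B UB Bl.
by case: (nBr Br).
Qed.

(** A bounded real sequence converges along every ultrafilter, by compactness;
    an ultrafilter containing the tails of [nat] makes the limit extend the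
    usual one. *)
Lemma generalized_limit_exists : exists (U : set_system nat) (nu : X),
  [/\ ProperFilter U, (nbhs \oo : set_system nat) `<=` U
    & forall y : linf, y n @[n --> U] --> (nu y : R^o)].
Proof.
have [U [UU oU]] := @ultraFilterLemma nat \oo _.
have PU : ProperFilter U by exact: ultra_proper.
have [nu nuP] := choice (fun y : linf => ultrafilter_bounded_cvg y UU).
have lnu : scalar (nu : linf -> R^o).
  move=> a y y'; apply: (@cvg_unique _ (@norm_hausdorff R R^o) _ _ _ _ (nuP _)).
  exact: cvgD (cvgM (cvg_cst (a : R^o)) (nuP y)) (nuP y').
have bnu y : `|nu y| <= 1 * `|y|.
  rewrite mul1r; apply: (@closed_cvg _ R^o U _ (fun n => `|y n|) (fun r : R^o => r <= `|y|)).
  - exact: closed_le.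
  - by apply: nearW => n; exact: norm_inf_ub.
  - exact: cvg_norm (nuP y).
have [mu muE] := topdualP lnu bnu.
by exists U, mu; split => // y; rewrite muE.
Qed.

End Functionals.

(** * The orthogonal of the Gossez operator *)

Section Gossez.
Variable R : realType.
Local Notation ell1 := (ell1 R).
Local Notation linf := (linf R).
Local Notation X := (topdual linf).
Local Notation Z := (X * linf)%type.

Definition sum1 (x : ell1) : R := limn (series x).

Lemma unit_seq_bounded n : (@unit_seq R n) \in @bounded_seq R.
Proof.
apply: (@bounded_seqP _ _ 1) => k; rewrite /unit_seq.
by case: (k == n); rewrite ?normr1 ?normr0.
Qed.
Definition unit_linf n : linf := Linf (unit_seq_bounded n).

Lemma one_bounded : (fun=> 1 : R^o) \in @bounded_seq R.
Proof. by apply: (@bounded_seqP _ _ 1) => k; rewrite normr1. Qed.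
Definition one_linf : linf := Linf one_bounded.

Lemma sign_bounded : (fun n => (-1) ^+ n : R^o) \in @bounded_seq R.
Proof. by apply: (@bounded_seqP _ _ 1) => k; rewrite normrX normrN1 expr1n. Qed.
Definition sign_linf : linf := Linf sign_bounded.

Lemma prefix_bounded N : (fun n => (n < N)%:R : R^o) \in @bounded_seq R.
Proof.
apply: (@bounded_seqP _ _ 1) => k.
by case: (k < N)%N; rewrite ?normr1 ?normr0.
Qed.
Definition prefix_linf N : linf := Linf (prefix_bounded N).

Lemma shift_bounded (y : linf) : (fun n => y n.+1) \in @bounded_seq R.
Proof. by have [M yM] := linf_bounded y; exact: (@bounded_seqP _ _ M). Qed.
Definition shift_linf (y : linf) : linf := Linf (shift_bounded y).

Lemma gossezE (x : ell1) n : gossez x n = sum1 x - series x n.+1 - series x n.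
Proof. exact: gossez_seqE. Qed.

Lemma series_cvg_sum1 (x : ell1) : series x @ \oo --> (sum1 x : R^o).
Proof. exact: ell1_series_cvg. Qed.

Lemma gossez_cvg (x : ell1) : gossez x n @[n --> \oo] --> (- sum1 x : R^o).
Proof.
under eq_fun do rewrite gossezE.
rewrite -[- sum1 x](_ : sum1 x - sum1 x - sum1 x = _); last by ring.
apply: (@cvgB _ R^o); last exact: series_cvg_sum1.
apply: (@cvgB _ R^o); first exact: cvg_cst.
by rewrite cvg_shiftS; exact: series_cvg_sum1.
Qed.

Lemma pairing_cvg_to (x : ell1) (y : linf) :
  series (fun n => x n * y n) @ \oo --> (pairing x y : R^o).
Proof. exact: pairing_cvg. Qed.

Lemma pairing_one (x : ell1) : pairing x one_linf = sum1 x.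
Proof.
by congr (limn (series _)); apply/funext => n; rewrite /= mulr1.
Qed.

(** With [s_N] the partial sums of [x] and [s] their limit, the terms of the
    pairing are [(s_(N+1) - s_N) * (s - s_(N+1) - s_N)] and telescope to
    [s * s_N - s_N ^+ 2]. *)
Lemma pairing_gossez (x : ell1) : pairing x (gossez x) = 0.
Proof.
apply: (@cvg_unique _ (@norm_hausdorff R R^o) _ _ _ _ (@pairing_cvg_to _ _)).
have -> : series (fun n => x n * gossez x n) =
    (fun N => sum1 x * series x N - series x N * series x N).
  apply/funext => N; elim: N => [|N IH].
    by rewrite /series /= !big_geq//; ring.
  rewrite seriesSr IH gossezE seriesSr.
  ring.
rewrite -[0](_ : sum1 x * sum1 x - sum1 x * sum1 x = 0); last by rewrite subrr.
apply: (@cvgB _ R^o); apply: cvgM; try exact: series_cvg_sum1; exact: cvg_cst.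
Qed.

Lemma pairingDl (a : R) (x x' : ell1) (y : linf) :
  pairing (a *: x + x') y = a * pairing x y + pairing x' y.
Proof.
apply: (@cvg_unique _ (@norm_hausdorff R R^o) _ _ _ _ (@pairing_cvg_to _ _)).
have -> : series (fun n => (a *: x + x') n * y n) =
    (fun N => a * series (fun n => x n * y n) N + series (fun n => x' n * y n) N).
  apply/funext => N; rewrite /series /= mulr_sumr -big_split /=.
  apply: eq_bigr => i _.
  by rewrite mulrA -mulrDl.
apply: (@cvgD _ R^o); last exact: pairing_cvg_to.
by apply: cvgM; [exact: cvg_cst|exact: pairing_cvg_to].
Qed.

Lemma gossez_graphP (z : Z) : op_graph (@gossez_op R) z <->
  exists x, z = (ell1_bidual x, gossez x).
Proof.
split=> [[x /= xz1 xz2]|[x ->]]; last by exists x.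
by exists x; case: z xz1 xz2 => /= ? ? -> ->.
Qed.

Lemma gossez_graph_linear : linear_set (op_graph (@gossez_op R)).
Proof.
have bilin (a : R) x x' : ell1_bidual (a *: x + x') = a *: ell1_bidual x + ell1_bidual x'.
  by apply/val_inj/funext => y; exact: pairingDl.
split.
  apply/gossez_graphP; exists 0; congr (_, _); last by rewrite linear0.
  by have := bilin (-1) 0 0; rewrite scaler0 addr0 scaleN1r addNr => ->.
move=> a z z' /gossez_graphP[x ->] /gossez_graphP[x' ->].
apply/gossez_graphP; exists (a *: x + x').
by rewrite bilin linearP.
Qed.

Lemma gossez_graph_skew : skew_set (op_graph (@gossez_op R)).
Proof. by move=> z /gossez_graphP[x ->]; exact: pairing_gossez. Qed.

Lemma perp_gossezP (z : Z) : perp (op_graph (@gossez_op R)) z <->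
  forall x, pairing x z.2 + z.1 (gossez x) = 0.
Proof.
split=> [h x|h w /gossez_graphP[x ->]]; last by rewrite /zdot addrC; exact: h.
by rewrite addrC; apply: (h (ell1_bidual x, gossez x)); apply/gossez_graphP; exists x.
Qed.

Lemma graph_orthogonal_gossez :
  graph_orthogonal (@gossez_graph1 R) = perp (op_graph (@gossez_op R)).
Proof.
apply/seteqP; split => z.
  by move=> h; apply/perp_gossezP => x; apply: (h (x, gossez x)); exists x.
by move=> /perp_gossezP h _ [x _ <-]; exact: h.
Qed.

Lemma pairingN (x : ell1) (y : linf) : pairing x (- y) = - pairing x y.
Proof. by have := topdualB (ell1_bidual x) 0 y; rewrite topdual0 !sub0r. Qed.

Lemma neg_adjointE :
  op_graph (neg_op (@gossez_adjoint R)) = perp (op_graph (@gossez_op R)).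
Proof.
apply/seteqP; split => z; rewrite /op_graph /neg_op /gossez_adjoint /=.
  move=> z2; apply/perp_gossezP => x.
  by rewrite -gossez_adjointP -z2 pairingN addrN.
move=> /perp_gossezP h; apply/esym/adjoint_unique => x.
by have := h x; rewrite pairingN; lra.
Qed.

Lemma gossez_unit n :
  gossez (unit_ell1 R n) = prefix_linf n + prefix_linf n.+1 - one_linf.
Proof.
have sE N : series (unit_ell1 R n) N = (n < N)%:R.
  elim: N => [|N IH]; first by rewrite /series /= big_geq.
  rewrite seriesSr IH /= /unit_seq ltnS.
  by case: (ltngtP N n); rewrite /= ?addr0 ?add0r.
have s1 : sum1 (unit_ell1 R n) = 1.
  apply/cvg_lim => //.
  have -> : (1 : R) = series (unit_ell1 R n) n.+1 by rewrite sE ltnSn.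
  by apply: series_eventually_cst => k nk; rewrite /= /unit_seq gtn_eqF.
apply/val_inj/funext => k.
rewrite -[RHS]/((k < n)%:R + (k < n.+1)%:R - 1 : R).
apply: etrans (gossezE _ _) _.
rewrite s1 !sE !ltnS; case: ltngtP => _ /=; ring.
Qed.

Section Decomposition.
Variable mu : X.

Let m (n : nat) : R^o := mu (unit_linf n).

Lemma topdual_prefix N : mu (prefix_linf N) = series m N.
Proof.
elim: N => [|N IH].
  rewrite /series /= big_geq// (_ : prefix_linf 0 = 0) ?topdual0//.
  by apply/val_inj/funext => k.
rewrite (_ : prefix_linf N.+1 = prefix_linf N + unit_linf N).
  by rewrite topdualD IH seriesSr.
apply/val_inj/funext => k.
rewrite -[RHS]/((k < N)%:R + (k == N)%:R : R) /= ltnS.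
by case: ltngtP; rewrite /= ?addr0 ?add0r.
Qed.

(** Evaluate [mu] at the sequence of the signs of the [m n], truncated at [N]: its
    norm is at most 1. *)
Lemma topdual_unit_summable : m \in @summable_seq R.
Proof.
have [M muM] := topdual_bounded mu.
have tb N : (fun n => if (n < N)%N then Num.sg (m n) else 0 : R^o) \in @bounded_seq R.
  apply: (@bounded_seqP _ _ 1) => k; case: ifP; rewrite ?normr0// normr_sg.
  by case: (_ == _).
pose q N : linf := Linf (tb N).
have qE N : mu (q N) = [normed series m] N.
  elim: N => [|N IH].
    rewrite (_ : q 0 = 0); last exact/val_inj/funext.
    by rewrite topdual0; apply/esym/big_geq.
  rewrite (_ : q N.+1 = q N + Num.sg (m N) *: unit_linf N).
    have -> : [normed series m] N.+1 = [normed series m] N + `|m N|.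
      exact: big_nat_recr.
    rewrite topdualD IH topdualZ; congr (_ + _).
    exact/esym/normrEsg.
  apply/val_inj/funext => k.
  rewrite -[RHS]/((if (k < N)%N then Num.sg (m k) else 0) +
    Num.sg (m N) * (k == N)%:R : R) /= ltnS.
  by case: ltngtP => [_|_|->]; rewrite /= ?mulr0 ?addr0 ?add0r ?mulr1.
apply/asboolP; apply: nondecreasing_is_cvgn.
  by apply: nondecreasing_series => *; exact: normr_ge0.
exists `|M| => _ [N _ <-]; rewrite -qE.
apply: le_trans (ler_norm _) _; apply: le_trans (muM _) _.
apply: (@le_trans _ _ (`|M| * `|q N|)); first by rewrite ler_wpM2r// ler_norm.
rewrite -[leRHS]mulr1 ler_wpM2l//.
apply: norm_inf_le => k /=; case: ifP; rewrite ?normr0// normr_sg.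
by case: (_ == _).
Qed.

Definition ell1_part : ell1 := Ell1 topdual_unit_summable.

(** Testing against the [n]-th unit vector, whose image by [gossez] is given by
    [gossez_unit], yields [y n = mu 1 - s_n - s_(n+1)], where [s_n] are the
    partial sums of the values of [mu] at the unit vectors. *)
Lemma perp_gossez_decomposition (y : linf) : perp (op_graph (@gossez_op R)) (mu, y) ->
  y = gossez ell1_part + (mu one_linf - sum1 ell1_part) *: one_linf.
Proof.
move=> /perp_gossezP h; apply/val_inj/funext => n.
rewrite -[RHS]/(gossez ell1_part n + (mu one_linf - sum1 ell1_part) * 1) mulr1 gossezE.
have := h (unit_ell1 R n); rewrite pairing_unit /= gossez_unit.
rewrite topdualB topdualD !topdual_prefix => e.
apply/eqP; rewrite -subr_eq0 -[X in _ == X]e; apply/eqP => /=; ring.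
Qed.

End Decomposition.

(** With [y = gossez x + c *: 1] and [s] the sum of [x], orthogonality to
    [(x, gossez x)] and skewness give [mu (gossez x) = - c * s], hence
    [mu y = c * (mu 1 - s) = c ^+ 2], while [nu y + mu 1 = 2 * c]. *)
Lemma perp_gossez_square (nu : X) (z : Z) :
  (forall x, nu (gossez x) = - sum1 x) -> nu one_linf = 1 ->
  perp (op_graph (@gossez_op R)) z ->
  4 * coupling z = zdot (nu, one_linf) z ^+ 2.
Proof.
case: z => mu y nuG nu1 muy; have yE := perp_gossez_decomposition muy.
set x := ell1_part mu in yE; set c := _ - _ in yE.
have : mu (gossez x) = - (c * sum1 x).
  have /perp_gossezP/(_ x)/= := muy.
  have -> : pairing x y = c * sum1 x.
    rewrite yE -[pairing x _]/(ell1_bidual x _) topdualD topdualZ /=.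
    by rewrite pairing_gossez pairing_one add0r.
  lra.
move=> muG; rewrite /coupling /zdot /=.
have -> : mu y = c ^+ 2 by rewrite yE topdualD topdualZ muG /c; ring.
have -> : nu y = c - sum1 x by rewrite yE topdualD topdualZ nuG nu1; ring.
by rewrite /c; ring.
Qed.

(** [nu1] is a generalized limit and [nu0] its difference with its shift: [nu0]
    vanishes at all convergent sequences, in particular at the unit vectors, but
    not at [(-1) ^+ n], so it is not given by a summable sequence. *)
Lemma gossez_functionals : exists nu1 nu0 : X,
  [/\ forall x, nu1 (gossez x) = - sum1 x, nu1 one_linf = 1,
      forall x, nu0 (gossez x) = 0 & forall x, ell1_bidual x <> nu0].
Proof.
have [U [nu [PU oU nuP]]] := generalized_limit_exists R.
have nu_lim (y : linf) (l : R) : y n @[n --> \oo] --> (l : R^o) -> nu y = l.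
  move=> yl; apply: (@cvg_unique _ (@norm_hausdorff R R^o) _ _ _ _ (nuP y)).
  by apply: cvg_trans yl => A /= yA; exact: oU.
have [nu0 nu0E] : exists nu0 : X, forall y, nu0 y = nu y - nu (shift_linf y).
  have [M nuM] := topdual_bounded nu.
  apply: (@topdualP R _ (2 * `|M|)) => [a y y'|y].
    rewrite topdualD topdualZ (_ : shift_linf _ = a *: shift_linf y + shift_linf y').
      by rewrite topdualD topdualZ; ring.
    exact/val_inj/funext.
  have nuM' y' : `|nu y'| <= `|M| * `|y'|.
    by apply: le_trans (nuM _) _; rewrite ler_wpM2r// ler_norm.
  have sy : `|shift_linf y| <= `|y| by apply: norm_inf_le => n; exact: (norm_inf_ub y n.+1).
  apply: le_trans (ler_normB _ _) _; rewrite -mulrA mulr_natl mulr2n lerD//.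
  by apply: le_trans (nuM' _) _; rewrite ler_wpM2l.
have nu0_lim (y : linf) (l : R) : y n @[n --> \oo] --> (l : R^o) -> nu0 y = 0.
  move=> yl; rewrite nu0E (nu_lim _ _ yl) (nu_lim _ l) ?subrr//.
  by rewrite /= cvg_shiftS.
exists nu, nu0; split.
- by move=> x; apply: nu_lim; exact: gossez_cvg.
- by apply: nu_lim; exact: cvg_cst.
- by move=> x; apply: nu0_lim (gossez_cvg (x := x)).
move=> x x0; have ev (y : linf) : nu0 y = pairing x y by rewrite -x0.
have xn n : x n = 0.
  have -> : x n = pairing x (unit_linf n).
    apply/esym/cvg_lim => //.
    have -> : x n = series (fun k => x k * unit_linf n k) n.+1.
      rewrite /series /= big_nat_recr//= /unit_seq eqxx mulr1 big_nat big1 ?add0r//.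
      by move=> i /andP[_ /ltn_eqF ->]; rewrite mulr0.
    by apply: series_eventually_cst => k nk; rewrite /= /unit_seq gtn_eqF// mulr0.
  rewrite -ev; apply: (nu0_lim _ 0); apply: cvg_near_cst; near=> k.
  rewrite /= /unit_seq gtn_eqF//; near: k; exact: nbhs_infty_gt.
have : nu0 sign_linf = 0.
  rewrite ev; apply/cvg_lim => //; apply: cvg_near_cst; apply: nearW => N.
  by rewrite /series /= big1// => i _; rewrite xn mul0r.
rewrite nu0E (_ : shift_linf _ = - sign_linf); last first.
  by apply/val_inj/funext => n; rewrite /= exprS mulN1r.
have := topdualB nu 0 sign_linf; rewrite topdual0 sub0r => -> s0.
have {}s0 : nu sign_linf = 0 by lra.
have := nuP sign_linf; rewrite s0 => /cvgrPdist_lt/(_ 1 ltr01)/filter_ex[n].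
by rewrite sub0r normrN /= normrX normrN1 expr1n ltxx.
Unshelve. all: by end_near. Qed.

End Gossez.

(** * Monotone extensions of the Gossez operator *)

Unset Implicit Arguments.

Theorem theorem4 (R : realType) :
  let G := op_graph (@gossez_op R) in
  let negG := op_graph (neg_op (@gossez_op R)) in
  let neg_adj := op_graph (neg_op (@gossez_adjoint R)) in
  compatible_topology (sigmaZ (linf R)) /\
  (* (i) *)
  ([/\ op_domain (@gossez_op R) `<` setT, skew_set G, monotone_set G & unique_monotone G] /\
   [/\ ~ NI G, ~ representable G, ~ closed_for (sigmaZ (linf R)) G,
       ~ dual_representable G & ~ maximal_monotone G] /\
   (forall M, maximal_monotone_extension G M <-> M = neg_adj) /\
   (G `<=` graph_orthogonal (@gossez_graph1 R) /\
    graph_orthogonal (@gossez_graph1 R) = neg_adj) /\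
   fitzpatrick G = indicator_fun R neg_adj /\
   (forall t, compatible_topology t ->
     let L := closure_for t G in
     [/\ fitzpatrick_conj G = indicator_fun R L,
         L = coincidence (fitzpatrick G) & L = coincidence (fitzpatrick_conj G)] /\
     [/\ linear_subspace L, skew_set L, unique_monotone L & representable L] /\
     [/\ ~ NI L, ~ dual_representable L & ~ maximal_monotone L] /\
     [/\ fitzpatrick G = fitzpatrick L & fitzpatrick_conj G = fitzpatrick_conj L] /\
     [/\ G `<` L, L = coincidence (fitzpatrick L),
         L = coincidence (fitzpatrick_conj L) & L `<` neg_adj])) /\
  (* (ii) *)
  ([/\ op_domain (neg_op (@gossez_op R)) `<` setT, NI negG & ~ maximal_monotone negG] /\
   (forall t, compatible_topology t ->
     let L := closure_for t G in
     [/\ forall M, maximal_monotone_extension negG M <-> M = closure_for t negG,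
         skew_set (closure_for t negG) & closure_for t negG = neg_set L])).
Proof.
move=> G negG neg_adj.
have lG : linear_set G by exact: gossez_graph_linear.
have sG : skew_set G by exact: gossez_graph_skew.
have NE : neg_adj = perp G by exact: neg_adjointE.
have [nu1 [nu0 [nu1G nu1e nu0G nu0x]]] := gossez_functionals R.
pose u : topdual (linf R) * linf R := (nu1, one_linf R).
have Gu : perp G u.
  by apply/perp_gossezP => x; rewrite /= nu1G pairing_one addrN.
have cu : coupling u = 1 by exact: nu1e.
have square w : perp G w -> 4 * coupling w = zdot u w ^+ 2.
  exact: perp_gossez_square.
have perp2E := perp2P lG sG square.
have GN : G `<=` perp G by exact: skew_sub_perp.
have LN : perp (perp G) `<=` perp G by exact: perp2_sub_perp.
have GL := @sub_perp2 _ _ G.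
have L0 : perp (perp G) (nu0, 0).
  rewrite perp2E; split; last exact: topdual0.
  by apply/perp_gossezP => x; rewrite /= nu0G addr0; exact: (topdual0 (ell1_bidual x)).
have G0 : ~ G (nu0, 0) by move=> /gossez_graphP[x [x0 _]]; exact: (nu0x x (esym x0)).
have GneqL : G <> perp (perp G) by move=> GE; apply: G0; rewrite GE.
have [ct dom] : compatible_topology (sigmaZ (linf R)) /\
    (op_domain (@gossez_op R) `<` setT /\ op_domain (neg_op (@gossez_op R)) `<` setT).
  split; first exact: sigma_compatible.
  by split; split=> // /(_ nu0 I)[y [x /= ]] /nu0x.
have closE t (ct' : compatible_topology t) : closure_for t G = perp (perp G).
  exact: closure_perp.
have fitzG : fitzpatrick G = indicator_fun R (perp G) by exact: fitzpatrick_skew.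
have fitzGc : fitzpatrick_conj G = indicator_fun R (perp (perp G)).
  exact: fitzpatrick_conj_skew.
have lL := linear_perp (perp G).
have sL : skew_set (perp (perp G)) by exact: skew_perp2.
have fitzL : fitzpatrick G = fitzpatrick (perp (perp G)).
  by rewrite fitzG fitzpatrick_skew// perp3.
have fitzLc : fitzpatrick_conj G = fitzpatrick_conj (perp (perp G)).
  by rewrite /fitzpatrick_conj fitzL.
have coinG : coincidence (fitzpatrick G) = perp (perp G).
  by rewrite fitzG coincidence_indicator -perp2E.
have coinGc : coincidence (fitzpatrick_conj G) = perp (perp G).
  by rewrite fitzGc coincidence_perp2.
have nrepG : ~ representable G by move=> /(representable_skew_closed lG sG).
split=> //; split.
  split; first split=> //.
  - exact: dom.1.
  - by apply: monotone_linear => // z /sG ->.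
  - exact: (unique_monotone_perp lG sG square).
  split; first split=> //.
  - exact: (not_NI_skew lG sG Gu cu).
  - move=> clG; apply: GneqL; rewrite -(closE _ ct).
    exact: (closure_id (G : set (Topological.Pack (sigmaZ (linf R))))).1 clG.
  - by move=> [f [fR _] GE]; apply: nrepG; exists f.
  - exact: (not_maximal_sub_perp2 lG sG Gu cu square GL).
  split; first by rewrite NE; exact: (maximal_extension_perp lG sG square).
  split; first by rewrite graph_orthogonal_gossez NE.
  split; first by rewrite NE.
  move=> t ct'; rewrite /= closE// NE.
  split=> //; split.
    split=> //; first exact/linear_subspaceP.
      exact: (unique_monotone_perp lG sG square).
    exact: representable_perp2 ct'.
  split.
    split.
    - move=> /(_ u); rewrite -fitzL fitzG indicator_in// cu lee_fin.
      by rewrite ler10.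
    - exact: (not_dual_representable_perp2 lG sG Gu cu square).
    - exact: (not_maximal_sub_perp2 lG sG Gu cu square (fun z Lz => Lz)).
  split=> //; split; rewrite -?fitzL -?fitzLc//.
    by split=> // LG; apply/G0/LG.
  by split=> // NL; apply: (not_perp2_u lG sG cu); exact: NL.
have negE : negG = neg_set G by [].
have lnG : linear_set (neg_set G) by exact: linear_neg.
have perpn : perp (neg_set G) = neg_set (perp G) by exact: perp_neg.
have perp2n : perp (perp (neg_set G)) = neg_set (perp (perp G)).
  by rewrite perpn perp_neg.
have snG : skew_set (neg_set G).
  by apply: sub_perp_skew; rewrite perpn; exact: neg_setS.
have cle0 z : perp (neg_set G) z -> coupling z <= 0.
  rewrite perpn => /(perp_coupling_ge0 square); rewrite coupling_neg; lra.
have ceq0 z : perp (neg_set G) z -> coupling z = 0 -> perp (perp (neg_set G)) z.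
  rewrite perp2n perpn /neg_set /= perp2E => Nz z0; split=> //=.
  by rewrite coupling_neg z0 oppr0.
have maxn := maximal_extension_perp2 lnG snG cle0 ceq0.
split.
  split; first exact: dom.2.
    exact: NI_skew.
  move=> maxG; have : neg_set G = perp (perp (neg_set G)) by apply/maxn; split.
  by rewrite perp2n => /(congr1 (@neg_set _ _)); rewrite !neg_setK => /GneqL.
move=> t ct'; rewrite /= closE// negE (closure_perp ct' lnG); split=> //.
exact: skew_perp2.
Qed.
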